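(* Let $G=\mathbb T^m$ be the $m$-torus group and let $P$ be a principal $G$-bundle with connection $\omega$ over a Riemannian manifold $(M,g_M)$ with projection map $\pi:P\to M$. Let $\{\varepsilon_n\}$ be a sequence of positive numbers converging to zero. Let $g_n$ be the connection metric on $P$ given by $$g_n=\pi^*g_M+\varepsilon_n^2 g_G$$ for a fixed bi-invariant metric $g_G$ on $G$. Then the wane groups of the sequence of tangent bundles $TP$ with the Sasaki metrics $g_n^S$ induced from $g_n$ are trivial: $G_x=\{1\}$ for every $x\in M$.
   Context: Connection metric: $\omega$ is a connection form with values in the Lie algebra $\mathfrak g$ of $G$, and $g_n=\pi^*g_M+\varepsilon_n^2g_G$ means $g_n(X,Y)=g_M(\pi_*X,\pi_*Y)+\varepsilon_n^2\, g_G(\omega(X),\omega(Y))$. Standing assumptions: manifolds are connected and the Riemannian manifolds considered are proper as metric spaces (closed balls are compact). Sasaki metric: the Sasaki metric $g^S$ on the tangent bundle of a Riemannian manifold with metric $g$ and Levi-Civita connection $\nabla$ is the unique Riemannian metric such that every curve $\gamma$ in the tangent bundle, with projected curve $\delta$ in the base, satisfies $\|\dot\gamma\|^2=\|\dot\delta\|_g^2+\|\nabla_{\dot\delta}\gamma\|_g^2$. Wane group: fix $x\in M$, $p\in\pi^{-1}(x)$, let $k=\dim P$ and identify $(T_pP,g_n)$ with Euclidean $\mathbb R^k$ by linear isometries. Let $H_n\le O(k)$ be the Levi-Civita holonomy group of $(P,g_n)$ at $p$, and for $a\in H_n$ let $L_n(a)$ be the infimum of the $g_n$-lengths of piecewise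 smooth loops at $p$ whose parallel translation is $a$. The restriction of the distance of $(TP,g_n^S)$ to $T_pP$ is $d_n(u,v)=\inf_{a\in H_n}\sqrt{L_n(a)^2+\|au-v\|^2}$. (Up to a subsequence and with suitable choices of the identifications) $d_n$ converges uniformly on compact sets to a semi-metric $d_\infty$ on $\mathbb R^k$. A wane group at $x$ is a compact subgroup $G_x\le O(k)$ such that $d_\infty(u,v)=0$ if and only if $v=gu$ for some $g\in G_x$; thus the fiber over $x$ of the limit $Y\to M$ of the bundles $(TP,g_n^S)\to(P,g_n)$ in the pointed Gromov-Hausdorff sense is homeomorphic to $\mathbb R^k/G_x$. It is considered up to conjugation by orthogonal matrices. *)

(* Defs.v *)
From HB Require Import structures.
From mathcomp Require Import all_boot all_order all_algebra.
From mathcomp Require Import all_classical all_reals all_analysis.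

Set Implicit Arguments.
Unset Strict Implicit.
Unset Printing Implicit Defensive.
Import Order.TTheory GRing.Theory Num.Theory.
Import numFieldNormedType.Exports.

Local Open Scope classical_set_scope.
Local Open Scope ring_scope.

Section Calculus.
Context {R : realType}.

Definition basis_vec {n} (i : 'I_n) : 'rV[R]_n := delta_mx 0 i.

(* [Cr_on r U f]: f is of class C^r on U.  Only used for U open. *)
Fixpoint Cr_on {n} (r : nat) (U : set 'rV[R]_n) (f : 'rV[R]_n -> R) : Prop :=
  match r with
  | 0 => forall x, U x -> {for x, continuous f}
  | r'.+1 => (forall x, U x -> differentiable f x) /\
      forall i, Cr_on r' U (fun x => 'D_(basis_vec i) f x)
  end.

Definition smooth_on {n p} (U : set 'rV[R]_n) (f : 'rV[R]_n -> 'rV[R]_p) :=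
  forall r j, Cr_on r U (fun x => f x 0 j).

(* Only depends on the germ of f at t; f is smooth on an open set when this
   holds at each of its points. *)
Definition infinitely_derivable (f : R -> R) (t : R) :=
  forall r, derivable (derive1n r f) t 1.

Definition dot {n} (u v : 'rV[R]_n) : R := (u *m v^T) 0 0.

Definition inner_product {n} (b : 'rV[R]_n -> 'rV[R]_n -> R) :=
  [/\ forall a u v w, b (a *: u + v) w = a * b u w + b v w,
      forall u v, b u v = b v u
    & forall u, u != 0 -> 0 < b u u].

End Calculus.

Section Manifolds.
Variable R : realType.

(* A chart is a homeomorphism, with inverse [cinv], from the open set [cdom]
   onto an open subset of R^n; [cmap] and [cinv] are junk elsewhere. *)
Record chart (T : topologicalType) (n : nat) := Chart {
  cdom : set T;
  cmap : T -> 'rV[R]_n;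
  cinv : 'rV[R]_n -> T;
  cdom_open : open cdom;
  cimg_open : open (cmap @` cdom);
  cmapK : forall x, cdom x -> cinv (cmap x) = x;
  cmap_continuous : forall x, cdom x -> {for x, continuous cmap};
  cinv_continuous : forall y, (cmap @` cdom) y -> {for y, continuous cinv}
}.

(* Connected smooth manifolds.  One chart of the atlas is singled out around
   each point; the tangent space at x is then R^n, a vector being given by its
   components in [chart_at x]. *)
Record manifold (n : nat) := Manifold {
  carrier :> topologicalType;
  atlas : set (chart carrier n);
  chart_at : carrier -> chart carrier n;
  chart_at_atlas : forall x, atlas (chart_at x);
  chart_at_dom : forall x, cdom (chart_at x) x;
  transition_smooth : forall c c', atlas c -> atlas c' ->
    smooth_on (cmap c @` (cdom c `&` cdom c')) (cmap c' \o cinv c);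
  manifold_hausdorff : hausdorff_space carrier;
  manifold_second_countable : @second_countable carrier;
  manifold_connected : connected [set: carrier]
}.

End Manifolds.

Section TangentVectors.
Context {R : realType}.

Definition cimg {T : topologicalType} {n} (c : chart R T n) : set 'rV[R]_n :=
  cmap c @` cdom c.

Definition to_chart {n} {M : manifold R n} (c : chart R M n) (x : M)
    (v : 'rV[R]_n) : 'rV[R]_n :=
  'd (cmap c \o cinv (chart_at x)) (cmap (chart_at x) x) v.

Definition of_chart {n} {M : manifold R n} (c : chart R M n) (x : M)
    (w : 'rV[R]_n) : 'rV[R]_n :=
  'd (cmap (chart_at x) \o cinv c) (cmap c x) w.

Definition smooth_map_on {n p} {M : manifold R n} {N : manifold R p}
    (U : set M) (f : M -> N) :=
  (forall x, U x -> {for x, continuous f}) /\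
  forall c c', atlas c -> atlas c' ->
    smooth_on (cmap c @` (cdom c `&` U `&` f @^-1` cdom c'))
      (cmap c' \o f \o cinv c).

Definition smooth_vec_on {n p} {M : manifold R n} (U : set M)
    (f : M -> 'rV[R]_p) :=
  forall c, atlas c -> smooth_on (cmap c @` (cdom c `&` U)) (f \o cinv c).

(* the differential T_x M -> T_(f x) N *)
Definition tangent_map {n p} {M : manifold R n} {N : manifold R p}
    (f : M -> N) (x : M) (v : 'rV[R]_n) : 'rV[R]_p :=
  'd (cmap (chart_at (f x)) \o f \o cinv (chart_at x))
    (cmap (chart_at x) x) v.

(* Smooth curves are parametrized by the whole line, and later restricted to
   [0, 1]; every smooth curve on [0, 1] is such a restriction. *)
Definition smooth_curve {n} {M : manifold R n} (c : R -> M) :=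
  continuous c /\
  forall k, atlas k -> forall t, cdom k (c t) ->
    forall i, infinitely_derivable (fun s => cmap k (c s) 0 i) t.

(* [w] is a vector field along the curve [c], with [w t] in T_(c t) M *)
Definition smooth_field_along {n} {M : manifold R n} (c : R -> M)
    (w : R -> 'rV[R]_n) :=
  forall k, atlas k -> forall t, cdom k (c t) ->
    forall i, infinitely_derivable (fun s => to_chart k (c s) (w s) 0 i) t.

Definition velocity {n} {M : manifold R n} (c : R -> M) (t : R) : 'rV[R]_n :=
  \row_i derive1 (fun s => cmap (chart_at (c t)) (c s) 0 i) t.

End TangentVectors.

Section RiemannianGeometry.
Context {R : realType} {n : nat} {M : manifold R n}.

Definition metric_field := M -> 'rV[R]_n -> 'rV[R]_n -> R.
Implicit Type g : metric_field.

Definition metric_coef g (c : chart R M n) (i j : 'I_n) (y : 'rV[R]_n) : R :=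
  g (cinv c y) (of_chart c (cinv c y) (basis_vec i))
    (of_chart c (cinv c y) (basis_vec j)).

Definition riemannian_metric g :=
  (forall x, inner_product (g x)) /\
  forall c, atlas c -> forall r i j, Cr_on r (cimg c) (metric_coef g c i j).

(* Christoffel symbols Gamma^k_ij of the Levi-Civita connection in the chart
   [c], at the point with coordinates [y]:
   1/2 sum_l g^kl (d_i g_jl + d_j g_il - d_l g_ij). *)
Definition christoffel g (c : chart R M n) (y : 'rV[R]_n) (k i j : 'I_n) : R :=
  2^-1 * \sum_l invmx (\matrix_(a, b) metric_coef g c a b y) k l *
    ('D_(basis_vec i) (metric_coef g c j l) y
     + 'D_(basis_vec j) (metric_coef g c i l) y
     - 'D_(basis_vec l) (metric_coef g c i j) y).

(* Levi-Civita covariant derivative at time t of the vector field w along c,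
   computed in the chart [chart_at (c t)], in which w t is its own coordinate
   vector. *)
Definition covariant_derivative g (c : R -> M) (w : R -> 'rV[R]_n) (t : R) :
    'rV[R]_n :=
  let k0 := chart_at (c t) in
  \row_k (derive1 (fun s => to_chart k0 (c s) (w s) 0 k) t
    + \sum_i \sum_j christoffel g k0 (cmap k0 (c t)) k i j
        * velocity c t 0 i * w t 0 j).

(* [chain step x y l]: x is joined to y by finitely many successive steps of
   total length l.  With the steps below, these are the piecewise smooth curves
   and their lengths. *)
Inductive chain (T : Type) (step : T -> T -> R -> Prop) (x : T) :
    T -> R -> Prop :=
| chain_nil : chain step x x 0
| chain_rcons y z l l' :
    chain step x y l -> step y z l' -> chain step x z (l + l').

Definition riemannian_step g (x y : M) (l : R) : Prop :=
  exists c : R -> M, [/\ smooth_curve c, c 0 = x, c 1 = y &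
    l = \int[lebesgue_measure]_(t in `[0, 1])
          Num.sqrt (g (c t) (velocity c t) (velocity c t))].

Definition riemannian_dist g (x y : M) : R :=
  inf [set l | chain (riemannian_step g) x y l].

Definition proper_metric g :=
  forall x r, compact [set y | riemannian_dist g x y <= r].

(* Points of TM are pairs (x, u) with u in T_x M.  A smooth curve in TM is a
   smooth curve c in M with a smooth field w along c, and its Sasaki speed is
   sqrt (|c'|^2 + |nabla_c' w|^2). *)
Definition sasaki_step g (u v : M * 'rV[R]_n) (l : R) : Prop :=
  exists (c : R -> M) (w : R -> 'rV[R]_n),
    [/\ smooth_curve c, smooth_field_along c w,
        (c 0, w 0) = u, (c 1, w 1) = v &
        l = \int[lebesgue_measure]_(t in `[0, 1])
              Num.sqrt (g (c t) (velocity c t) (velocity c t)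
                + g (c t) (covariant_derivative g c w t)
                          (covariant_derivative g c w t))].

Definition sasaki_dist g (u v : M * 'rV[R]_n) : R :=
  inf [set l | chain (sasaki_step g) u v l].

End RiemannianGeometry.

Arguments metric_field {R n} M.

Section PrincipalTorusBundles.
Context {R : realType} {n m : nat} {M : manifold R n} {P : manifold R (n + m)}.

Definition integral_vec (t : 'rV[R]_m) := forall i, t 0 i \is a Num.int.

(* The torus T^m is R^m / Z^m, with Lie algebra R^m and exponential map the
   quotient map.  A right action of T^m is given by the corresponding action
   of R^m; it is a free action of T^m when the stabilizers are exactly Z^m. *)
Definition free_torus_action (act : P -> 'rV[R]_m -> P) :=
  [/\ forall p, act p 0 = p,
      forall p s t, act (act p s) t = act p (s + t)
    & forall p s t, act p s = act p t <-> integral_vec (s - t)].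

Definition smooth_action (act : P -> 'rV[R]_m -> P) :=
  continuous (fun z : P * 'rV[R]_m => act z.1 z.2) /\
  forall c c', atlas c -> atlas c' ->
    let f (y : 'rV[R]_(n + m + m)) := act (cinv c (lsubmx y)) (rsubmx y) in
    smooth_on [set y | cimg c (lsubmx y) /\ cdom c' (f y)] (cmap c' \o f).

(* The section s over U trivializes the bundle: (x, t) |-> s(x).t is a
   diffeomorphism from U x T^m onto the part of P over U.  It is smooth and
   bijective for a smooth action satisfying the other bundle axioms; its
   inverse is p |-> (pi p, tau p mod Z^m), and a map to T^m is smooth when it
   lifts locally to smooth maps to R^m. *)
Definition trivializing_section (pi : P -> M) (act : P -> 'rV[R]_m -> P)
    (U : set M) (s : M -> P) :=
  [/\ smooth_map_on U s,
      forall x, U x -> pi (s x) = x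
    & forall p, U (pi p) -> exists (W : set P) (tau : P -> 'rV[R]_m),
        [/\ open W, W p, W `<=` pi @^-1` U, smooth_vec_on W tau
          & forall q, W q -> q = act (s (pi q)) (tau q)]].

Definition principal_torus_bundle (pi : P -> M) (act : P -> 'rV[R]_m -> P) :=
  [/\ smooth_map_on setT pi /\ set_surj setT setT pi,
      free_torus_action act,
      smooth_action act,
      forall p q, pi p = pi q <-> exists t, q = act p t
    & forall x, exists (U : set M) (s : M -> P),
        [/\ open U, U x & trivializing_section pi act U s]].

(* R^m-valued 1-forms; T^m being abelian, the adjoint action in the
   equivariance condition is trivial. *)
Definition connection_form (act : P -> 'rV[R]_m -> P)
    (omega : P -> 'rV[R]_(n + m) -> 'rV[R]_m) :=
  [/\ forall p a u v, omega p (a *: u + v) = a *: omega p u + omega p v,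
      forall c, atlas c -> forall i, smooth_on (cimg c)
        (fun y => omega (cinv c y) (of_chart c (cinv c y) (basis_vec i))),
      forall p xi, omega p (velocity (fun t : R => act p (t *: xi)) 0) = xi
    & forall p t v, omega (act p t) (tangent_map (act^~ t) p v) = omega p v].

(* A bi-invariant metric on the abelian group T^m is the same as an inner
   product gG on its Lie algebra R^m. *)
Definition connection_metric (pi : P -> M) (gM : metric_field M)
    (omega : P -> 'rV[R]_(n + m) -> 'rV[R]_m) (gG : 'rV[R]_m -> 'rV[R]_m -> R)
    (eps : R) : metric_field P :=
  fun p u v => gM (pi p) (tangent_map pi p u) (tangent_map pi p v)
               + eps ^+ 2 * gG (omega p u) (omega p v).

End PrincipalTorusBundles.

Section WaneGroups.
Context {R : realType} {k : nat}.

Definition linear_isometry (b : 'rV[R]_k -> 'rV[R]_k -> R)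
    (iota : {linear 'rV[R]_k -> 'rV[R]_k}) :=
  forall u v, b (iota u) (iota v) = dot u v.

(* [iota j] identifies R^k with (T_p P, g j); [dinf] is the limit, along the
   subsequence [sub] and uniformly on compact sets, of the restrictions d_j to
   T_p P of the distances of the Sasaki metrics. *)
Definition sasaki_fiber_limit {P : manifold R k} (g : nat -> metric_field P)
    (p : P) (dinf : 'rV[R]_k -> 'rV[R]_k -> R) :=
  exists (iota : nat -> {linear 'rV[R]_k -> 'rV[R]_k}) (sub : nat -> nat),
    [/\ forall j, linear_isometry (g j p) (iota j),
        {homo sub : i j / (i < j)%N}
      & {family compact,
          (fun j (uv : 'rV[R]_k * 'rV[R]_k) =>
             sasaki_dist (g (sub j)) (p, iota (sub j) uv.1)
                                     (p, iota (sub j) uv.2)) @ \oo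
          --> (fun uv => dinf uv.1 uv.2)}].

Definition compact_orthogonal_group (G : set 'M[R]_k) :=
  [/\ forall A, G A -> A *m A^T = 1%:M,
      G 1%:M,
      forall A B, G A -> G B -> G (A *m B),
      forall A, G A -> G (invmx A)
    & compact G].

(* Vectors are rows, so the image of u by the matrix A is u *m A^T. *)
Definition wane_group (dinf : 'rV[R]_k -> 'rV[R]_k -> R) (G : set 'M[R]_k) :=
  compact_orthogonal_group G /\
  forall u v, dinf u v = 0 <-> exists A, G A /\ v = u *m A^T.

End WaneGroups.

(* Main.v *)
Require Import Defs.
From HB Require Import structures.
From mathcomp Require Import all_boot all_order all_algebra.
From mathcomp Require Import all_classical all_reals all_analysis.
From mathcomp Require Import ring lra.
Import Order.TTheory GRing.Theory Num.Theory.
Import numFieldNormedType.Exports.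
Local Open Scope classical_set_scope.
Local Open Scope ring_scope.
Set Implicit Arguments.
Unset Strict Implicit.
Unset Printing Implicit Defensive.

(** Why the wane groups are trivial.  It is enough that the limit semi-metric
    separates the points of the fiber of TP over p: its zero classes are the
    orbits of the wane group, and an orthogonal group all of whose orbits are
    points is trivial.  So, for u <> v, the Sasaki distances between the vectors
    of T_p P that correspond to u and v have to be bounded below uniformly in
    the size eps of the torus fibers, although these fibers, and with them many
    loops through p, become arbitrarily short.

    The reason is a bound on the Levi-Civita connection which comes from the
    commutativity of the torus.  Over a small ball of M with coordinates x,
    consider the coframe theta = (dx, eps omega).  It is defined on the whole
    preimage of the ball, so it is single-valued around the torus fibers.  In
    it the metric has the coefficients gM(x) and gG, which do not depend on eps.
    Locally omega = dtau + A(x) dx ([connection_decomposition]), so that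
    d theta = (0, eps dA) is bounded ([kk_frame_struct]); for a nonabelian group
    there would be a further term of order 1 / eps.  By the Koszul formula
    ([frame_koszul], [christoffel_koszul]) the connection forms in a coframe
    depend only on its exterior derivative and on the derivatives of the
    coefficients of the metric, so they are bounded uniformly in eps
    ([christoffel_frame_ler]).  Consequently, along a curve of TP with Sasaki
    speed S, the components W of the vector satisfy |W'| <= C (1 + |W|) S
    ([frame_derivative_ler_speed]) and the base coordinates satisfy |x'| <= C S.

    These differential inequalities hold only over the ball.  Instead of
    following a curve until it leaves the ball, apply them to the function
    max (0, 1 - a |x - x0|^2 - b |W - W0|^2)^2, where W0 are the components of
    the first vector, extended by zero outside the preimage of the ball.  For
    suitable a and b it is continuously differentiable along every smooth curve
    of TP, its derivative there is at most L S, and it takes the values 1 and 0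
    at the two given vectors; so the distance between them is at least 1 / L
    ([separator_sasaki_dist]).  The constants L, a and b can be chosen
    independently of eps <= 1 ([kk_adapted_frame], [sasaki_fiber_separation]). *)

(** * Differentials and second derivatives *)

Lemma near_continuous {T U : topologicalType} (f g : T -> U) (x : T) :
  (\forall y \near x, f y = g y) -> {for x, continuous f} -> {for x, continuous g}.
Proof.
move=> fg cf; change (g @ nbhs x --> g x); rewrite -(nbhs_singleton fg).
exact: cvg_trans (near_eq_cvg fg) cf.
Qed.

Section Germs.
Context {R : realType} {V W : normedModType R}.

Lemma near_is_diff (f g : V -> W) (df : V -> W) (x : V) :
  (\forall y \near x, f y = g y) -> is_diff x f df -> is_diff x g df.
Proof.
move=> fg dfx.
have [dc dfo] := (diff_locallyP x f).1 (@ex_diff _ _ _ _ _ _ _ dfx).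
have fgx := nbhs_singleton fg.
have e : g \o shift x = cst (g x) + 'd f x +o_ 0 id.
  apply/eqaddoP => _/posnumP[e].
  have /eqaddoP /(_ e%:num) /(_ [gt0 of e%:num]) := dfo.
  have fg0 : \forall h \near (0:V), f (h + x) = g (h + x).
    by move: fg; rewrite (near_shift 0)/=; apply: filterS => h; rewrite subr0.
  apply: filter_app; apply: filterS fg0 => h fgh /=.
  by rewrite -![(_ + _ : _ -> _) _]/(_ + _) -![(- _ : _ -> _) _]/(- _) /= fgh /cst fgx.
have d := diff_unique dc e.
split; last by rewrite d; exact: diff_val.
apply/diff_locallyP; split; first by rewrite d.
by rewrite d.
Qed.

Lemma near_diff (f g : V -> W) (x : V) :
  (\forall y \near x, f y = g y) -> differentiable f x ->
  'd g x = 'd f x :> (V -> W).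
Proof. by move=> fg /differentiableP/(near_is_diff fg)[]. Qed.

Lemma near_differentiable (f g : V -> W) (x : V) :
  (\forall y \near x, f y = g y) -> differentiable f x -> differentiable g x.
Proof. by move=> fg /differentiableP/(near_is_diff fg)[]. Qed.

End Germs.

Section Coordinates.
Context {R : realType} {V : normedModType R}.

Lemma row_sum_coord {p} (f : V -> 'rV[R]_p) :
  f = fun y => \sum_(j < p) f y 0 j *: delta_mx 0 j.
Proof. by apply/funext => y; rewrite -row_sum_delta. Qed.

Lemma differentiable_row {p} (f : V -> 'rV[R]_p) (x : V) :
  (forall j, differentiable (fun y => f y 0 j) x) -> differentiable f x.
Proof.
move=> df; rewrite (row_sum_coord f).
have := @differentiable_sum R V 'rV[R]_p p
  (fun j y => f y 0 j *: (delta_mx 0 j : 'rV[R]_p)) x.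
rewrite fct_sumE; apply => j.
exact: differentiableZl.
Qed.

Lemma is_diff_coord {p} (f : V -> 'rV[R]_p) (x : V) (j : 'I_p) :
  differentiable f x ->
  is_diff x (fun y => f y 0 j) (fun v => 'd f x v 0 j).
Proof.
move=> df.
have L : linear (fun w : 'rV[R]_p => w 0 j : R) by move=> a u v; rewrite !mxE.
pose LM := GRing.isLinear.Build _ _ _ _ _ L.
pose l : {linear _ -> _} := HB.pack (fun w : 'rV[R]_p => w 0 j : R) LM.
have dl : is_diff (f x) (fun w : 'rV[R]_p => w 0 j : R) (fun w => w 0 j).
  split; first exact: differentiable_coord.
  by rewrite -[X in 'd X _]/(l : _ -> _) diff_lin //; exact: coord_continuous.
have := is_diff_comp (differentiableP df) dl.
by [].
Qed.

Lemma diff_coord {p} (f : V -> 'rV[R]_p) (x v : V) (j : 'I_p) :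
  differentiable f x -> 'd (fun y => f y 0 j : R) x v = 'd f x v 0 j.
Proof. by move=> /(is_diff_coord j)/@diff_val ->. Qed.

End Coordinates.

Section Partials.
Context {R : realType} {n : nat}.
Implicit Types (x v : 'rV[R]_n).

Lemma diff_basis {W : normedModType R} (f : 'rV[R]_n -> W) x v :
  'd f x v = \sum_i v 0 i *: 'd f x (basis_vec i).
Proof.
rewrite [in LHS](row_sum_delta v) linear_sum; apply: eq_bigr => i _.
by rewrite linearZ.
Qed.

Lemma diff_partial (f : 'rV[R]_n -> R) x v : differentiable f x ->
  'd f x v = \sum_i v 0 i * 'D_(basis_vec i) f x.
Proof.
by move=> df; rewrite diff_basis; apply: eq_bigr => i _; rewrite deriveE.
Qed.

End Partials.

Lemma eq_of_common_approx {R : realType} (A B : R) :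
  (forall e, 0 < e -> exists C, `|A - C| < e /\ `|B - C| < e) -> A = B.
Proof.
move=> h; apply/eqP; rewrite -subr_eq0 -normr_eq0; apply/negPn/negP => n0.
have p : 0 < `|A - B| by rewrite lt_def n0 normr_ge0.
have [C [hA hB]] := h (`|A - B| / 2) (divr_gt0 p (ltr0n _ 2)).
have : `|A - B| < `|A - B|; last by rewrite ltxx.
rewrite [X in _ < X]splitr -{1}(subrKA C) (le_lt_trans (ler_normD _ _)) //.
by rewrite ltrD // distrC.
Qed.

Section Schwarz.
Context {R : realType} {V : normedModType R}.

Lemma is_derive_line (f : V -> R) (x a : V) (s : R) :
  differentiable f (x + s *: a) ->
  is_derive s (1:R) (fun s' => f (x + s' *: a)) ('D_a f (x + s *: a)).
Proof.
move=> df.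
have dl : is_diff s (fun s' : R => x + s' *: a) (fun s' => s' *: a).
  have [ex val] := is_diffD (is_diff_cst x s) (is_diff_scalel s a).
  split; first exact: ex.
  by apply: etrans val _; rewrite add0r.
have := is_diff_comp dl (differentiableP df).
case=> ex val; split; first exact/derivable1_diffP.
by rewrite deriveE // val /= scale1r deriveE.
Qed.

(** The mean value theorem, applied once in each direction. The left-hand side
    is symmetric in a and b, which is the source of the symmetry of second
    derivatives. *)
Lemma second_difference (f : V -> R) (U : set V) (x a b : V) (d : R) :
  0 < d ->
  (forall s t, 0 <= s <= d -> 0 <= t <= d -> U (x + s *: a + t *: b)) ->
  (forall y, U y -> differentiable f y) ->
  (forall y, U y -> differentiable ('D_a f) y) ->
  exists s t, [/\ 0 <= s <= d, 0 <= t <= d &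
    f (x + d *: a + d *: b) - f (x + d *: a) - f (x + d *: b) + f x
      = d * d * 'D_b ('D_a f) (x + s *: a + t *: b)].
Proof.
move=> d0 Ux df dDf.
pose u s := f (x + d *: b + s *: a) - f (x + s *: a).
have du s : 0 <= s <= d ->
    is_derive s (1:R) u ('D_a f (x + d *: b + s *: a) - 'D_a f (x + s *: a)).
  move=> sd; apply: is_deriveB; apply: is_derive_line.
    by apply: df; rewrite addrAC; apply: Ux; rewrite // lexx ltW.
  by apply: df; rewrite -[_ + _ *: _]addr0 -(scale0r b); apply: Ux; rewrite // lexx ltW.
have [||s sd su] := MVT d0 (f := u)
    (df := fun s => 'D_a f (x + d *: b + s *: a) - 'D_a f (x + s *: a)).
- by move=> s; rewrite in_itv /= => /andP[/ltW s0 /ltW sd]; apply: du; rewrite s0.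
- apply: derivable_within_continuous => s; rewrite in_itv /= => sd.
  by have [] := du s sd.
have {}sd : 0 <= s <= d by move: sd; rewrite in_itv /= => /andP[/ltW -> /ltW ->].
pose w t := 'D_a f (x + s *: a + t *: b).
have dw t : 0 <= t <= d -> is_derive t (1:R) w ('D_b ('D_a f) (x + s *: a + t *: b)).
  by move=> td; apply: is_derive_line; apply: dDf; apply: Ux.
have [||t td tw] := MVT d0 (f := w) (df := fun t => 'D_b ('D_a f) (x + s *: a + t *: b)).
- by move=> t; rewrite in_itv /= => /andP[/ltW t0 /ltW td]; apply: dw; rewrite t0.
- apply: derivable_within_continuous => t; rewrite in_itv /= => td.
  by have [] := dw t td.
exists s, t; split => //.
  by move: td; rewrite in_itv /= => /andP[/ltW -> /ltW ->].
move: su tw; rewrite /u /w !scale0r !addr0 !subr0 => su tw.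
rewrite [x + d *: a + _]addrAC.
transitivity (f (x + d *: b + d *: a) - f (x + d *: a) - (f (x + d *: b) - f x)).
  by ring.
rewrite su [x + d *: b + _]addrAC tw; ring.
Qed.

(** At small scales, both mixed derivatives approximate the same second
    difference quotient. *)
Lemma derive_swap (f : V -> R) (U : set V) (x a b : V) :
  open U -> U x ->
  (forall y, U y -> differentiable f y) ->
  (forall y, U y -> differentiable ('D_a f) y) ->
  (forall y, U y -> differentiable ('D_b f) y) ->
  {for x, continuous ('D_a ('D_b f))} ->
  {for x, continuous ('D_b ('D_a f))} ->
  'D_a ('D_b f) x = 'D_b ('D_a f) x.
Proof.
move=> oU Ux df dDa dDb cab cba.
apply: eq_of_common_approx => e e0.
have N : \forall y \near x, [/\
    `|'D_a ('D_b f) x - 'D_a ('D_b f) y| < e ,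
    `|'D_b ('D_a f) x - 'D_b ('D_a f) y| < e & U y].
  have h1 : \forall y \near x, `|'D_a ('D_b f) x - 'D_a ('D_b f) y| < e.
    by exact: (cvgrPdist_lt _ _).1 cab _ e0.
  have h2 : \forall y \near x, `|'D_b ('D_a f) x - 'D_b ('D_a f) y| < e.
    by exact: (cvgrPdist_lt _ _).1 cba _ e0.
  have h3 : nbhs x U by exact: open_nbhs_nbhs.
  apply: filterS3 h1 h2 h3 => y; exact: And3.
have [r /= r0 Nr] := (nbhs_ballP _ _).1 N.
pose d := r / 2 / (`|a| + `|b| + 1).
have ab1 : 0 < `|a| + `|b| + 1 by rewrite ltr_wpDl // addr_ge0.
have d0 : 0 < d by rewrite !divr_gt0.
have Nst s t : 0 <= s <= d -> 0 <= t <= d -> ball x r (x + s *: a + t *: b).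
  move=> /andP[s0 sd] /andP[t0 td].
  rewrite -ball_normE /ball_ /= -addrA opprD addNKr normrN.
  rewrite (le_lt_trans (ler_normD _ _)) // !normrZ !ger0_norm //.
  apply: (@le_lt_trans _ _ (d * (`|a| + `|b| + 1))).
    rewrite !mulrDr mulr1 -addrA lerD ?ler_wpM2r // ler_wpDr ?ler_wpM2r //.
    exact: ltW.
  by rewrite divfK ?gt_eqF // ltr_pdivrMr // ltr_pMr // ltr1n.
have Nts s t : 0 <= s <= d -> 0 <= t <= d -> ball x r (x + s *: b + t *: a).
  by move=> sd td; rewrite addrAC; exact: Nst.
have U1 s t : 0 <= s <= d -> 0 <= t <= d -> U (x + s *: a + t *: b).
  by move=> sd td; have [_ _ +] := Nr _ (Nst s t sd td).
have U2 s t : 0 <= s <= d -> 0 <= t <= d -> U (x + s *: b + t *: a).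
  by move=> sd td; have [_ _ +] := Nr _ (Nts s t sd td).
have [s [t [sd td e1]]] := second_difference d0 U1 df dDa.
have [s' [t' [sd' td' e3]]] := second_difference d0 U2 df dDb.
have E : 'D_b ('D_a f) (x + s *: a + t *: b) = 'D_a ('D_b f) (x + s' *: b + t' *: a).
  have dd : d * d != 0 by rewrite mulf_neq0 ?gt_eqF.
  apply: (mulfI dd); apply: etrans (esym e1) (etrans _ e3).
  by congr (_ + _); rewrite [x + d *: a + _]addrAC [LHS]addrAC.
have [_ h1 _] := Nr _ (Nst s t sd td).
have [h2 _ _] := Nr _ (Nts s' t' sd' td').
exists ('D_b ('D_a f) (x + s *: a + t *: b)); split; last exact: h1.
by rewrite E; exact: h2.
Qed.

End Schwarz.

Lemma Cr_on_swap {R : realType} {n} (U : set 'rV[R]_n) (f : 'rV[R]_n -> R) x i j :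
  open U -> U x -> Cr_on 2 U f ->
  'D_(basis_vec i) ('D_(basis_vec j) f) x = 'D_(basis_vec j) ('D_(basis_vec i) f) x.
Proof.
move=> oU Ux /= [df Df]; apply: (derive_swap oU Ux df).
- exact: (Df i).1.
- exact: (Df j).1.
- exact: ((Df j).2 i x Ux).
- exact: ((Df i).2 j x Ux).
Qed.

(** * Continuous differentiability at a point *)

Section ContinuouslyDifferentiable.
Context {R : realType} {V : normedModType R}.

(** Continuity of the differential is asked at x alone; this is enough to
    bound the differential near x, and it is stable under sums, products and
    composition. *)
Definition C1_at (f : V -> R) (x : V) :=
  (\forall y \near x, differentiable f y) /\
  forall v, {for x, continuous (fun y => 'd f y v)}.

End ContinuouslyDifferentiable.

Section ContinuouslyDifferentiableTheory.
Context {R : realType} {V : normedModType R}.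
Implicit Types (f g : V -> R) (x : V).

Lemma C1_at_differentiable f x : C1_at f x -> differentiable f x.
Proof. by case=> /nbhs_singleton. Qed.

Lemma C1_at_continuous f x : C1_at f x -> {for x, continuous f}.
Proof. by move=> /C1_at_differentiable/differentiable_continuous. Qed.

Lemma near_C1_at f g x : (\forall y \near x, f y = g y) -> C1_at f x -> C1_at g x.
Proof.
move=> fg [df cf].
have fg2 : \forall y \near x, \forall z \near y, f z = g z by exact: nbhs_interior.
split.
  by apply: filterS2 fg2 df => y fgy; exact: near_differentiable.
move=> v; apply: near_continuous (cf v).
by apply: filterS2 fg2 df => y fgy dfy; rewrite (near_diff fgy dfy).
Qed.

Lemma C1_at_cst (c : R) x : C1_at (fun=> c) x.
Proof.
split; first by apply: nearW => y; exact: differentiable_cst.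
move=> v; rewrite (_ : (fun _ => _) = cst 0); first exact: cvg_cst.
by apply/funext => y; rewrite [X in X v = _](diff_cst c).
Qed.

Lemma C1_at_D f g x : C1_at f x -> C1_at g x -> C1_at (fun y => f y + g y) x.
Proof.
move=> [df cf] [dg cg]; split.
  by apply: filterS2 df dg => y; exact: differentiableD.
move=> v; apply: (@near_continuous _ _ (fun y => 'd f y v + 'd g y v)).
  by apply: filterS2 df dg => y dfy dgy; rewrite [in RHS](diffD dfy dgy).
exact: continuousD (cf v) (cg v).
Qed.

Lemma C1_at_M f g x : C1_at f x -> C1_at g x -> C1_at (fun y => f y * g y) x.
Proof.
move=> Cf Cg; have [[df cf] [dg cg]] := (Cf, Cg); split.
  by apply: filterS2 df dg => y; exact: differentiableM.
move=> v; apply: (@near_continuous _ _ (fun y => f y * 'd g y v + g y * 'd f y v)).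
  by apply: filterS2 df dg => y dfy dgy; rewrite [in RHS](diffM dfy dgy).
apply: continuousD; apply: continuousM.
- exact: C1_at_continuous.
- exact: cg.
- exact: C1_at_continuous.
- exact: cf.
Qed.

Lemma C1_at_Z (c : R) f x : C1_at f x -> C1_at (fun y => c * f y) x.
Proof. by apply: C1_at_M; exact: C1_at_cst. Qed.

Lemma C1_at_sum {I : Type} (s : seq I) (F : I -> V -> R) x :
  (forall i, C1_at (F i) x) -> C1_at (fun y => \sum_(i <- s) F i y) x.
Proof.
move=> CF; elim: s => [|i s IH].
  apply: near_C1_at (C1_at_cst 0 x); apply: nearW => y; by rewrite big_nil.
apply: near_C1_at (C1_at_D (CF i) IH); apply: nearW => y; by rewrite big_cons.
Qed.

Lemma C1_at_comp {n} (f : 'rV[R]_n -> R) (g : V -> 'rV[R]_n) x :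
  (forall i, C1_at (fun y => g y 0 i) x) -> C1_at f (g x) ->
  C1_at (fun y => f (g y)) x.
Proof.
move=> Cg [df cf].
have dg : \forall y \near x, differentiable g y.
  have : \forall y \near x, forall i, differentiable (fun y => g y 0 i) y.
    by apply: filter_forall => i; have [] := Cg i.
  by apply: filterS => y; exact: differentiable_row.
have gc : {for x, continuous g} by apply: differentiable_continuous; exact: nbhs_singleton dg.
have df' : \forall y \near x, differentiable f (g y) by exact: (gc _ df).
split.
  by apply: filterS2 dg df' => y dgy dfy; exact: differentiable_comp.
move=> v; apply: (@near_continuous _ _ (fun y => \sum_i 'd (fun y => g y 0 i) y v * 'd f (g y) (basis_vec i))).
  apply: filterS2 dg df' => y dgy dfy; rewrite [in RHS](diff_comp dgy dfy) /=.
  by rewrite [RHS]diff_basis; apply: eq_bigr => i _; rewrite diff_coord.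
rewrite (_ : (fun _ => _) = \sum_i (fun y => 'd (fun y => g y 0 i) y v * 'd f (g y) (basis_vec i))); last first.
  by apply/funext => y; rewrite fct_sumE.
elim/big_ind: _ => [|a b ca cb|i _]; first exact: cvg_cst.
  exact: continuousD.
apply: continuousM; first by have [_] := Cg i; exact.
exact: (continuous_comp gc (cf (basis_vec i))).
Qed.

Lemma C1_at_compR (p p' : R -> R) f x :
  (forall s, is_derive s (1:R) p (p' s)) -> continuous p' ->
  C1_at f x -> C1_at (fun y => p (f y)) x.
Proof.
move=> dp cp' Cf; have [df cf] := Cf; split.
  apply: filterS df => y dfy; apply: differentiable_comp => //.
  by apply/derivable1_diffP; have [] := dp (f y).
move=> v; apply: (@near_continuous _ _ (fun y => 'd f y v * p' (f y))).
  apply: filterS df => y dfy.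
  have [dpy vpy] := dp (f y).
  rewrite [in RHS](diff_comp dfy) /=; last exact/derivable1_diffP.
  rewrite -vpy -derive1E derive1E' ?linearZ; last exact/derivable1_diffP.
  by rewrite -[in RHS](mulr1 ('d f y v)) [RHS]linearZ.
apply: continuousM; first exact: cf.
exact: (continuous_comp (C1_at_continuous Cf) (cp' (f x))).
Qed.

End ContinuouslyDifferentiableTheory.

Lemma Cr_on_C1_at {R : realType} {n} (U : set 'rV[R]_n) (f : 'rV[R]_n -> R) x :
  open U -> U x -> Cr_on 1 U f -> C1_at f x.
Proof.
move=> oU Ux /= [df Df].
have nU : \forall y \near x, U y by exact: open_nbhs_nbhs.
split; first by apply: filterS nU => y; exact: df.
move=> v; apply: (@near_continuous _ _ (fun y => \sum_i v 0 i * 'D_(basis_vec i) f y)).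
  by apply: filterS nU => y /df dfy; rewrite diff_partial.
rewrite (_ : (fun _ => _) = \sum_i (fun y => v 0 i * 'D_(basis_vec i) f y)); last first.
  by apply/funext => y; rewrite fct_sumE.
elim/big_ind: _ => [|a b ca cb|i _]; first exact: (@cst_continuous _ _ (0:R)).
  exact: continuousD.
apply: continuousM; last exact: (Df i x Ux).
exact: cst_continuous.
Qed.

(** The hypothesis is on a neighborhood because the iterated derivatives at t
    alone do not make f derivable at nearby points. *)
Lemma infinitely_derivable_C1_at {R : realType} (f : R -> R) t :
  (\forall s \near t, infinitely_derivable f s) -> C1_at f t.
Proof.
move=> h.
have df : \forall s \near t, differentiable f s.
  by apply: filterS h => s /(_ 0); move=> /= /derivable1_diffP.
split=> // v.
have cf' : {for t, continuous (derive1 f : R -> R)}.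
  apply: differentiable_continuous; apply/derivable1_diffP.
  exact: (nbhs_singleton h 1).
have cvf : {for t, continuous (fun s : R => v * derive1 f s)}.
  by apply: continuousM cf'; exact: cst_continuous.
apply: near_continuous cvf.
by apply: filterS df => s /derivable1_diffP/deriv1E ->.
Qed.

(** * Charts and changes of coordinates *)

Section ChartBasics.
Context {R : realType} {T : topologicalType} {n : nat}.
Implicit Types (c : chart R T n) (q : T) (y : 'rV[R]_n).

Lemma cimg_cdom c y : cimg c y -> cdom c (cinv c y).
Proof. by move=> [q dq <-]; rewrite cmapK. Qed.

Lemma cinvK c y : cimg c y -> cmap c (cinv c y) = y.
Proof. by move=> [q dq <-]; rewrite cmapK. Qed.

Lemma cimg_cmap c q : cdom c q -> cimg c (cmap c q).
Proof. by move=> dq; exists q. Qed.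

Lemma open_chart_image c (O : set T) :
  open O -> open (cmap c @` (cdom c `&` O)).
Proof.
move=> oO; rewrite (_ : _ @` _ = cimg c `&` cinv c @^-1` O).
  rewrite openE => y [cy Oy].
  have nc : nbhs y (cimg c) by apply: open_nbhs_nbhs; split=> //; exact: cimg_open.
  have nO : nbhs y (cinv c @^-1` O).
    by apply: (cinv_continuous cy); apply: open_nbhs_nbhs.
  by apply: filterS2 nc nO => z.
apply/seteqP; split=> y.
  by move=> [q [dq Oq] <-]; split; [exact: cimg_cmap|rewrite /= cmapK].
move=> [cy Oy]; exists (cinv c y); first by split=> //; exact: cimg_cdom.
exact: cinvK.
Qed.

Lemma near_cimg c q : cdom c q -> \forall y \near cmap c q, cimg c y.
Proof.
move=> dq; apply: open_nbhs_nbhs; split; first exact: cimg_open.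
exact: cimg_cmap.
Qed.

Lemma near_cdom c q : cdom c q -> \forall q' \near q, cdom c q'.
Proof. by move=> dq; apply: open_nbhs_nbhs; split=> //; exact: cdom_open. Qed.

Lemma near_cinv c q (A : set T) :
  cdom c q -> nbhs q A -> \forall y \near cmap c q, A (cinv c y).
Proof.
move=> dq nA; apply: (cinv_continuous (cimg_cmap dq)).
by rewrite cmapK.
Qed.

End ChartBasics.

Section ChangeOfChart.
Context {R : realType} {n : nat} {M : manifold R n}.
Implicit Types (c : chart R M n) (q : M).

Lemma chart_diff c c' q : atlas c -> atlas c' -> cdom c q -> cdom c' q ->
  differentiable (cmap c' \o cinv c) (cmap c q).
Proof.
move=> ac ac' dq dq'; apply: differentiable_row => j.
have /= [h _] := transition_smooth ac ac' 1 j.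
by apply: h; exists q.
Qed.

Lemma diff_chart_id c q : cdom c q ->
  is_diff (cmap c q) (cmap c \o cinv c) id.
Proof.
move=> dq; apply: near_is_diff (is_diff_id _).
by apply: filterS (near_cimg dq) => y cy; rewrite /= cinvK.
Qed.

(** The change of charts on the source is a change of variables; applied to
    the charts themselves it gives the cocycle relation between them. *)
Lemma diff_source_chart {W : normedModType R} (f : M -> W) c c' q :
  atlas c -> atlas c' -> cdom c q -> cdom c' q ->
  differentiable (f \o cinv c) (cmap c q) ->
  is_diff (cmap c' q) (f \o cinv c')
    ('d (f \o cinv c) (cmap c q) \o 'd (cmap c \o cinv c') (cmap c' q)).
Proof.
move=> ac ac' dq dq' df.
have d1 := differentiableP (chart_diff ac' ac dq' dq).
have d2 : is_diff ((cmap c \o cinv c') (cmap c' q)) (f \o cinv c) ('d (f \o cinv c) (cmap c q)).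
  by rewrite /= cmapK //; exact: differentiableP.
apply: near_is_diff (is_diff_comp d1 d2).
apply: filterS (near_cinv dq' (near_cdom dq)) => y dy.
by rewrite /= cmapK.
Qed.

Lemma diff_target_chart {V : normedModType R} (h : V -> M) (x : V) c c' :
  atlas c -> atlas c' -> cdom c (h x) -> cdom c' (h x) ->
  {for x, continuous h} -> differentiable (cmap c \o h) x ->
  is_diff x (cmap c' \o h)
    ('d (cmap c' \o cinv c) (cmap c (h x)) \o 'd (cmap c \o h) x).
Proof.
move=> ac ac' dq dq' ch dh.
have d1 := differentiableP dh.
have d2 := differentiableP (chart_diff ac ac' dq dq').
apply: near_is_diff (is_diff_comp d1 d2).
have nd : \forall y \near x, cdom c (h y) by exact: (ch _ (near_cdom dq)).
by apply: filterS nd => y dy; rewrite /= cmapK.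
Qed.

Lemma to_chartK c q v : atlas c -> cdom c q -> of_chart c q (to_chart c q v) = v.
Proof.
move=> ac dq; have dk := chart_at_dom q; have ak := chart_at_atlas q.
have [_ e] := diff_source_chart ac ak dq dk (chart_diff ac ak dq dk).
have [_ e'] := diff_chart_id dk.
by have := congr1 (fun f => f v) (etrans (esym e) e').
Qed.

Lemma of_chartK c q v : atlas c -> cdom c q -> to_chart c q (of_chart c q v) = v.
Proof.
move=> ac dq; have dk := chart_at_dom q; have ak := chart_at_atlas q.
have [_ e] := diff_source_chart ak ac dk dq (chart_diff ak ac dk dq).
have [_ e'] := diff_chart_id dq.
by have := congr1 (fun f => f v) (etrans (esym e) e').
Qed.

Lemma of_chart_at q v : of_chart (chart_at q) q v = v.
Proof.
by have [_ e'] := diff_chart_id (chart_at_dom q); exact: (congr1 (fun f => f v) e').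
Qed.

Lemma to_chart_at q v : to_chart (chart_at q) q v = v.
Proof. exact: of_chart_at. Qed.

Lemma of_chart_lin c q : linear (of_chart c q).
Proof. by move=> a u v; rewrite /of_chart linearP. Qed.

Lemma to_chart_lin c q : linear (to_chart c q).
Proof. by move=> a u v; rewrite /to_chart linearP. Qed.

Lemma diff_chart_at {W : normedModType R} (f : M -> W) c q v :
  atlas c -> cdom c q -> differentiable (f \o cinv c) (cmap c q) ->
  'd (f \o cinv (chart_at q)) (cmap (chart_at q) q) v =
  'd (f \o cinv c) (cmap c q) (to_chart c q v).
Proof.
move=> ac dq df; have dk := chart_at_dom q; have ak := chart_at_atlas q.
have [_ e] := diff_source_chart ac ak dq dk df.
exact: (congr1 (fun g => g v) e).
Qed.

Lemma diff_of_chart {W : normedModType R} (f : M -> W) c q v :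
  atlas c -> cdom c q ->
  differentiable (f \o cinv (chart_at q)) (cmap (chart_at q) q) ->
  'd (f \o cinv (chart_at q)) (cmap (chart_at q) q) (of_chart c q v) =
  'd (f \o cinv c) (cmap c q) v.
Proof.
move=> ac dq df; have dk := chart_at_dom q; have ak := chart_at_atlas q.
have [_ e] := diff_source_chart ak ac dk dq df.
exact: (esym (congr1 (fun g => g v) e)).
Qed.

End ChangeOfChart.

Section TangentMaps.
Context {R : realType} {n p : nat} {M : manifold R n} {N : manifold R p}.
Implicit Types (f : M -> N).

Lemma smooth_map_diff (U : set M) f c c' q :
  smooth_map_on U f -> U q -> atlas c -> atlas c' -> cdom c q -> cdom c' (f q) ->
  differentiable (cmap c' \o f \o cinv c) (cmap c q).
Proof.
move=> [_ sf] Uq ac ac' dq dq'; apply: differentiable_row => j.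
have /= [h _] := sf c c' ac ac' 1 j.
by apply: h; exists q.
Qed.

(** The differential of a map read in arbitrary charts of the atlas, rather
    than in the charts attached to the two points. *)
Lemma to_chart_tangent_map (U : set M) f c c' q v :
  smooth_map_on U f -> U q -> atlas c -> atlas c' -> cdom c q -> cdom c' (f q) ->
  to_chart c' (f q) (tangent_map f q v) =
  'd (cmap c' \o f \o cinv c) (cmap c q) (to_chart c q v).
Proof.
move=> sf Uq ac ac' dq dq'.
have dk := chart_at_dom q; have ak := chart_at_atlas q.
have dl := chart_at_dom (f q); have al := chart_at_atlas (f q).
rewrite -(diff_chart_at (f := cmap c' \o f)) //; last exact: smooth_map_diff sf _ _ _ _ _.
have := @diff_target_chart R p N _ (f \o cinv (chart_at q)) (cmap (chart_at q) q) (chart_at (f q)) c'.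
rewrite /= !cmapK // => /(_ al ac' dl dq').
case.
- have := cinv_continuous (cimg_cmap dk) => ck.
  apply: (continuous_comp ck); rewrite cmapK //; exact: sf.1.
- exact: smooth_map_diff sf _ _ _ _ _.
- by move=> _ e; exact: (esym (congr1 (fun g => g _) e)).
Qed.

End TangentMaps.

Section Curves.
Context {R : realType} {n : nat} {M : manifold R n}.
Implicit Types (c : R -> M) (k : chart R M n).

Lemma near_curve c t (A : set M) : smooth_curve c -> nbhs (c t) A ->
  \forall s \near t, A (c s).
Proof. by move=> [cc _]; exact: cc. Qed.

Lemma curve_C1_at c k t i : smooth_curve c -> atlas k -> cdom k (c t) ->
  C1_at (fun s => cmap k (c s) 0 i) t.
Proof.
move=> sc ak dk; apply: infinitely_derivable_C1_at.
by apply: filterS (near_curve sc (near_cdom dk)) => s ds; exact: sc.2.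
Qed.

Lemma field_C1_at c w k t i : smooth_curve c -> smooth_field_along c w ->
  atlas k -> cdom k (c t) -> C1_at (fun s => to_chart k (c s) (w s) 0 i) t.
Proof.
move=> sc sw ak dk; apply: infinitely_derivable_C1_at.
by apply: filterS (near_curve sc (near_cdom dk)) => s ds; exact: sw.
Qed.

Lemma curve_diff c k t : smooth_curve c -> atlas k -> cdom k (c t) ->
  differentiable (cmap k \o c) t.
Proof.
by move=> sc ak dk; apply: differentiable_row => i; apply: C1_at_differentiable; exact: curve_C1_at.
Qed.

Lemma velocityE c t : smooth_curve c ->
  velocity c t = 'd (cmap (chart_at (c t)) \o c) t 1.
Proof.
move=> sc; apply/rowP => i; rewrite mxE.
have ak := chart_at_atlas (c t); have dk := chart_at_dom (c t).
rewrite derive1E'; last by apply: C1_at_differentiable; exact: curve_C1_at.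
by rewrite -diff_coord //; exact: curve_diff.
Qed.

Lemma to_chart_velocity c k t : smooth_curve c -> atlas k -> cdom k (c t) ->
  to_chart k (c t) (velocity c t) = 'd (cmap k \o c) t 1.
Proof.
move=> sc ak dk; rewrite velocityE //.
have al := chart_at_atlas (c t); have dl := chart_at_dom (c t).
have [_ e] := diff_target_chart al ak dl dk (sc.1 t) (curve_diff sc al dl).
exact: (esym (congr1 (fun g => g 1) e)).
Qed.

End Curves.

(** * Norms, bilinear forms and derivatives of matrices *)

Section RowNorm.
Context {R : realType}.

Lemma coord_ler {n} (u : 'rV[R]_n) i : `|u 0 i| <= `|u|.
Proof. by rewrite [leRHS]/Num.Def.normr /= mx_normrE; apply: (le_bigmax _ _ (0, i)). Qed.

Lemma row_norm_ler {n} (v : 'rV[R]_n) : `|v| <= \sum_i `|v 0 i|.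
Proof.
rewrite [leLHS]/Num.Def.normr /= mx_normrE; apply: bigmax_le.
  by apply: sumr_ge0.
move=> [i j] _ /=; rewrite (ord1 i) (bigD1 j) //= lerDl.
by apply: sumr_ge0.
Qed.

Lemma row_norm_le {n} (v : 'rV[R]_n) (B : R) :
  0 <= B -> (forall i, `|v 0 i| <= B) -> `|v| <= B.
Proof.
move=> B0 vB; rewrite [leLHS]/Num.Def.normr /= mx_normrE; apply: bigmax_le => //.
by move=> [i j] _ /=; rewrite (ord1 i).
Qed.

Lemma sqr_norm_ler_sum {n} (v : 'rV[R]_n) : `|v| ^+ 2 <= \sum_i v 0 i ^+ 2.
Proof.
have S0 : 0 <= \sum_i v 0 i ^+ 2 by apply: sumr_ge0 => i _; exact: sqr_ge0.
have h : `|v| <= Num.sqrt (\sum_i v 0 i ^+ 2).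
  apply: row_norm_le => [|i]; first exact: sqrtr_ge0.
  rewrite -sqrtr_sqr ler_wsqrtr // (bigD1 i) //= lerDl.
  by apply: sumr_ge0 => j _; exact: sqr_ge0.
by rewrite -[leRHS]sqr_sqrtr // lerXn2r // nnegrE ?sqrtr_ge0.
Qed.

Lemma row_mx_norm_ge {n m} (a : 'rV[R]_n) (b : 'rV[R]_m) :
  `|a| <= `|row_mx a b| /\ `|b| <= `|row_mx a b|.
Proof.
split; apply: row_norm_le => // i.
  by rewrite -(row_mxEl a b); exact: coord_ler.
by rewrite -(row_mxEr a b); exact: coord_ler.
Qed.

End RowNorm.

Section MatrixForms.
Context {R : realType} {N : nat}.
Implicit Types (A : 'M[R]_N) (u v : 'rV[R]_N).

Definition mform A u v : R := (u *m A *m v^T) 0 0.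

Lemma mformE A u v : mform A u v = \sum_j \sum_i u 0 i * A i j * v 0 j.
Proof.
rewrite /mform mxE; apply: eq_bigr => j _; rewrite !mxE mulr_suml.
by apply: eq_bigr.
Qed.

Lemma mformDl A u u' v : mform A (u + u') v = mform A u v + mform A u' v.
Proof. by rewrite /mform !mulmxDl mxE. Qed.

Lemma mformZl A a u v : mform A (a *: u) v = a * mform A u v.
Proof. by rewrite /mform -!scalemxAl mxE. Qed.

Lemma mformBl A u u' v : mform A (u - u') v = mform A u v - mform A u' v.
Proof. by rewrite mformDl -scaleN1r mformZl mulN1r. Qed.

Lemma mform_sym A u v : A^T = A -> mform A u v = mform A v u.
Proof.
move=> sA; have h : (v *m A *m u^T)^T = u *m A *m v^T.
  by rewrite !trmx_mul trmxK sA mulmxA.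
by rewrite /mform -h mxE.
Qed.

Lemma mform_ler A u v (K : R) : (forall i j, `|A i j| <= K) ->
  `|mform A u v| <= N%:R ^+ 2 * K * `|u| * `|v|.
Proof.
move=> AK; rewrite mformE.
apply: le_trans (ler_norm_sum _ _ _) _.
apply: (@le_trans _ _ (\sum_(j < N) \sum_(i < N) (`|u| * K * `|v|))).
  apply: ler_sum => j _; apply: le_trans (ler_norm_sum _ _ _) _.
  apply: ler_sum => i _; rewrite !normrM.
  by rewrite !ler_pM ?mulr_ge0 // coord_ler.
rewrite !sumr_const card_ord -mulrnA -[leLHS]mulr_natl natrM.
by rewrite le_eqVlt; apply/orP; left; apply/eqP; ring.
Qed.

Lemma mformPr A u a v w : mform A u (a *: v + w) = a * mform A u v + mform A u w.
Proof. by rewrite /mform linearP /= mulmxDr -scalemxAr mxE [X in X + _ = _]mxE. Qed.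

Lemma mformPm a A B u v : mform (a *: A + B) u v = a * mform A u v + mform B u v.
Proof. by rewrite /mform mulmxDr mulmxDl -scalemxAr -scalemxAl mxE [X in X + _ = _]mxE. Qed.

Lemma mform_basis A u l : mform A u (basis_vec l) = \sum_i u 0 i * A i l.
Proof. by rewrite /mform trmx_delta -colE !mxE. Qed.

Lemma unit_of_posdef A : (forall v, v != 0 -> 0 < mform A v v) -> A \in unitmx.
Proof.
move=> pA; rewrite -row_free_unit -kermx_eq0; apply/rowV0P => v /sub_kermxP vA.
apply/eqP/negPn/negP => /pA; rewrite /mform vA mul0mx mxE ltxx.
by [].
Qed.

End MatrixForms.

Lemma mform_block {R : realType} {n m} (A : 'M[R]_n) (B : 'M[R]_m) a b c d :
  mform (block_mx A 0 0 B) (row_mx a b) (row_mx c d) = mform A a c + mform B b d.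
Proof.
rewrite /mform mul_row_block !mulmx0 addr0 add0r tr_row_mx mul_row_col.
by rewrite mxE.
Qed.

Section MatrixDerivative.
Context {R : realType} {V : normedModType R}.

Definition dmx {p q} (A : V -> 'M[R]_(p, q)) (x X : V) : 'M[R]_(p, q) :=
  \matrix_(i, j) 'd (fun y => A y i j) x X.

Definition mx_differentiable {p q} (A : V -> 'M[R]_(p, q)) (x : V) :=
  forall i j, differentiable (fun y => A y i j) x.

Lemma is_diff_mulmx_entry {p q r} (A : V -> 'M[R]_(p, q)) (B : V -> 'M[R]_(q, r)) x i j :
  mx_differentiable A x -> mx_differentiable B x ->
  is_diff x (fun y => (A y *m B y) i j)
    (fun X => (dmx A x X *m B x + A x *m dmx B x X) i j).
Proof.
move=> dA dB.
have -> : (fun y => (A y *m B y) i j) = \sum_k (fun y => A y i k * B y k j).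
  by apply/funext => y; rewrite fct_sumE mxE.
have -> : (fun X => (dmx A x X *m B x + A x *m dmx B x X) i j) =
    \sum_k (fun X => A x i k * 'd (fun y => B y k j) x X + B x k j * 'd (fun y => A y i k) x X).
  apply/funext => X; rewrite fct_sumE !mxE -big_split /=; apply: eq_bigr => k _.
  by rewrite !mxE addrC; congr (_ + _); rewrite mulrC.
elim/big_rec2: _ => [|k f g _ IH]; first exact: is_diff_cst.
apply: is_diffD => //.
have [ex val] := is_diffM (differentiableP (dA i k)) (differentiableP (dB k j)).
split; first exact: ex.
by apply: etrans val _; apply/funext => v.
Qed.

Lemma mx_differentiable_mul {p q r} (A : V -> 'M[R]_(p, q)) (B : V -> 'M[R]_(q, r)) x :
  mx_differentiable A x -> mx_differentiable B x ->
  mx_differentiable (fun y => A y *m B y) x.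
Proof. by move=> dA dB i j; have [] := is_diff_mulmx_entry i j dA dB. Qed.

Lemma dmxM {p q r} (A : V -> 'M[R]_(p, q)) (B : V -> 'M[R]_(q, r)) x X :
  mx_differentiable A x -> mx_differentiable B x ->
  dmx (fun y => A y *m B y) x X = dmx A x X *m B x + A x *m dmx B x X.
Proof.
by move=> dA dB; apply/matrixP => i j; rewrite mxE; have [_ ->] := is_diff_mulmx_entry i j dA dB.
Qed.

Lemma mx_differentiable_tr {p q} (A : V -> 'M[R]_(p, q)) x :
  mx_differentiable A x -> mx_differentiable (fun y => (A y)^T) x.
Proof.
move=> dA i j; rewrite (_ : (fun y => _) = (fun y => A y j i)) //.
by apply/funext => y; rewrite mxE.
Qed.

Lemma dmx_tr {p q} (A : V -> 'M[R]_(p, q)) x X :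
  dmx (fun y => (A y)^T) x X = (dmx A x X)^T.
Proof.
apply/matrixP => i j; rewrite !mxE; congr ('d _ _ X).
by apply/funext => y; rewrite mxE.
Qed.

Lemma dmxP {p q} (A : V -> 'M[R]_(p, q)) (x : V) a X Y :
  dmx A x (a *: X + Y) = a *: dmx A x X + dmx A x Y.
Proof. by apply/matrixP => i j; rewrite !mxE linearP. Qed.

Lemma near_dmx {p q} (A B : V -> 'M[R]_(p, q)) x X :
  (\forall y \near x, A y = B y) -> mx_differentiable A x ->
  dmx A x X = dmx B x X.
Proof.
move=> AB dA; apply/matrixP => i j; rewrite !mxE.
apply/esym; have := @near_diff _ _ _ (fun y => A y i j) (fun y => B y i j) x.
by move=> /(_ _ (dA i j)) ->//; apply: filterS AB => y ->.
Qed.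

Lemma near_mx_differentiable {p q} (A B : V -> 'M[R]_(p, q)) x :
  (\forall y \near x, A y = B y) -> mx_differentiable A x -> mx_differentiable B x.
Proof.
move=> AB dA i j; apply: near_differentiable (dA i j).
by apply: filterS AB => y ->.
Qed.

End MatrixDerivative.

(** * The Koszul formula in a moving frame *)

Section FrameKoszul.
Context {R : realType} {N : nat}.

(** The metric is g = Th G Th^T, and c is the exterior derivative of the
    coframe with matrix Th. In the Koszul combination of the derivatives of g
    the symmetric part of the derivative of Th adds up to the first term on
    the right; all that remains involves only c and the derivatives of G. *)
Lemma frame_koszul (g G Th : 'rV[R]_N -> 'M[R]_N) (y X Y Z : 'rV[R]_N) :
  mx_differentiable G y -> mx_differentiable Th y ->
  (\forall y' \near y, g y' = Th y' *m G y' *m (Th y')^T) ->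
  (G y)^T = G y ->
  let th u := u *m Th y in
  let c u v := v *m dmx Th y u - u *m dmx Th y v in
  mform (dmx g y X) Y Z + mform (dmx g y Y) X Z - mform (dmx g y Z) X Y =
  2 * mform (G y) (Y *m dmx Th y X) (th Z)
  + (mform (G y) (th Y) (c X Z) + mform (G y) (th X) (c Y Z) - mform (G y) (c X Y) (th Z)
     + mform (dmx G y X) (th Y) (th Z) + mform (dmx G y Y) (th X) (th Z)
     - mform (dmx G y Z) (th X) (th Y)).
Proof.
move=> dG dT gE sG th c.
have dTr := mx_differentiable_tr dT.
have dTG := mx_differentiable_mul dT dG.
have dgE W : dmx g y W = dmx Th y W *m G y *m (Th y)^T + Th y *m dmx G y W *m (Th y)^T
    + Th y *m G y *m (dmx Th y W)^T.
  have -> : dmx g y W = dmx (fun y => Th y *m G y *m (Th y)^T) y W.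
    apply/esym; apply: near_dmx; first by apply: filterS gE => y' ->.
    exact: mx_differentiable_mul.
  by rewrite (dmxM _ dTG dTr) (dmxM _ dT dG) dmx_tr mulmxDl.
have mE W u v : mform (dmx g y W) u v = mform (G y) (u *m dmx Th y W) (th v)
    + mform (dmx G y W) (th u) (th v) + mform (G y) (th u) (v *m dmx Th y W).
  by rewrite dgE /mform !mulmxDr !mulmxDl [LHS]mxE [X in X + _ = _]mxE /th !trmx_mul !mulmxA.
have mBr u v w : mform (G y) u (v - w) = mform (G y) u v - mform (G y) u w.
  by rewrite mform_sym // mformBl [mform _ v _]mform_sym // [mform _ w _]mform_sym.
rewrite !mE /c !mBr !mformBl.
rewrite [mform (G y) (th Y) (X *m _)]mform_sym //.
rewrite [mform (G y) (th Y) (Z *m dmx Th y X)]mform_sym //.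
rewrite [mform (G y) (th X) (Z *m dmx Th y Y)]mform_sym //.
rewrite [mform (G y) (th X) (Y *m _)]mform_sym //.
ring.
Qed.

End FrameKoszul.

Section Christoffel.
Context {R : realType} {N : nat} {P : manifold R N}.
Variables (g : metric_field P) (k : chart R P N) (y : 'rV[R]_N).

Definition metric_mx (y : 'rV[R]_N) : 'M[R]_N := \matrix_(i, j) metric_coef g k i j y.

Definition christoffel_vec (X Y : 'rV[R]_N) : 'rV[R]_N :=
  \row_h \sum_i \sum_j christoffel g k y h i j * X 0 i * Y 0 j.

(** The inverse matrix in the definition of the Christoffel symbols cancels
    against the metric, which leaves the Koszul combination of derivatives. *)
Lemma christoffel_koszul X Y Z :
  mx_differentiable metric_mx y -> (metric_mx y)^T = metric_mx y ->
  metric_mx y \in unitmx ->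
  2 * mform (metric_mx y) (christoffel_vec X Y) Z =
  mform (dmx metric_mx y X) Y Z + mform (dmx metric_mx y Y) X Z
  - mform (dmx metric_mx y Z) X Y.
Proof.
move=> dg sg ug.
pose L Z := mform (dmx metric_mx y X) Y Z + mform (dmx metric_mx y Y) X Z
  - mform (dmx metric_mx y Z) X Y.
have linL : linear (L : 'rV[R]_N -> R).
  move=> a u v; rewrite /L dmxP !mformPr mformPm /GRing.scale /=; ring.
pose LM := GRing.isLinear.Build _ _ _ _ _ linL.
pose l : {linear 'rV[R]_N -> R} := HB.pack L LM.
have dgE W i j : dmx metric_mx y W i j = \sum_h W 0 h * 'D_(basis_vec h) (metric_coef g k i j) y.
  have -> : metric_coef g k i j = (fun z => metric_mx z i j).
    by apply/funext => z; rewrite mxE.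
  by rewrite mxE diff_partial.
pose T : 'rV[R]_N := \row_h L (basis_vec h).
have TE h : T 0 h = \sum_i \sum_j X 0 i * Y 0 j *
   ('D_(basis_vec i) (metric_coef g k j h) y + 'D_(basis_vec j) (metric_coef g k i h) y
    - 'D_(basis_vec h) (metric_coef g k i j) y).
  rewrite mxE /L !mform_basis mformE.
  under eq_bigr do rewrite dgE mulr_sumr.
  under [X in _ + X - _]eq_bigr do rewrite dgE mulr_sumr.
  rewrite [X in X + _ - _]exchange_big [X in _ - X]exchange_big /=.
  rewrite -big_split -sumrB /=; apply: eq_bigr => i _.
  rewrite -big_split -sumrB /=; apply: eq_bigr => j _.
  rewrite dgE (bigD1 h) //= big1 ?addr0; last first.
    by move=> h' hh'; rewrite /basis_vec mxE eqxx (negbTE hh') mul0r.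
  rewrite /basis_vec mxE !eqxx mul1r; ring.
have GE : christoffel_vec X Y = 2^-1 *: (T *m (invmx (metric_mx y))^T).
  apply/rowP => h; rewrite !mxE mulr_sumr.
  under [RHS]eq_bigr do rewrite TE mxE.
  rewrite /christoffel.
  under [RHS]eq_bigr do rewrite mulr_suml mulr_sumr.
  rewrite [RHS]exchange_big /=; apply: eq_bigr => i _.
  under [RHS]eq_bigr do rewrite mulr_suml mulr_sumr.
  rewrite [RHS]exchange_big /=; apply: eq_bigr => j _.
  rewrite -mulrA mulr_sumr mulr_suml; apply: eq_bigr => h' _.
  rewrite -[\matrix_(a, b) _]/(metric_mx y); ring.
rewrite GE mformZl mulrA mulfV ?pnatr_eq0 // mul1r /mform.
rewrite trmx_inv sg -(mulmxA T) mulVmx // mulmx1.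
rewrite -/(L Z) -[L Z]/(l Z) [in RHS](row_sum_delta Z) linear_sum mxE.
by apply: eq_bigr => h _; rewrite linearZ /= !mxE mulrC.
Qed.

End Christoffel.

(** * Adapted frames *)

(** In the Koszul formula there are three terms with the exterior derivative
    of the frame, bounded through K ^ 2, and three with the derivatives of the
    coefficients, bounded through K; the denominator comes from coercivity. *)
Definition frame_const {R : realType} (N : nat) (K lam : R) : R :=
  3 * N%:R ^+ 2 * K * (K + 1) / (2 * lam).

Section AdaptedFrames.
Context {R : realType} {N : nat} {P : manifold R N}.
Implicit Types (th : P -> 'rV[R]_N -> 'rV[R]_N) (G : P -> 'M[R]_N) (Om : set P).

Definition frame_mx th (k : chart R P N) (y : 'rV[R]_N) : 'M[R]_N :=
  \matrix_(i, j) th (cinv k y) (of_chart k (cinv k y) (basis_vec i)) 0 j.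

(** What controls the Levi-Civita connection of g on Om: a coframe th, the
    coefficients G of g in it, and bounds K and lam that a whole family of
    metrics may share. The bounds are relative to |th X|, so that they do not
    depend on the chart in which the derivatives are taken. *)
Record adapted_frame (g : metric_field P) Om th G (K lam : R) : Prop := {
  frame_open : open Om;
  frame_linear : forall q, linear (th q);
  frame_inj : forall q v, Om q -> th q v = 0 -> v = 0;
  frame_metric : forall q u v, Om q -> g q u v = mform (G q) (th q u) (th q v);
  frame_sym : forall q, Om q -> (G q)^T = G q;
  frame_lam : 0 < lam;
  frame_coercive : forall q v, Om q -> lam * `|v| ^+ 2 <= mform (G q) v v;
  frame_K : 0 <= K;
  frame_bounded : forall q i j, Om q -> `|G q i j| <= K;
  frame_C1 : forall k q i j, atlas k -> cdom k q -> Om q ->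
    C1_at (fun y => frame_mx th k y i j) (cmap k q);
  frame_diff : forall q, Om q ->
    mx_differentiable (G \o cinv (chart_at q)) (cmap (chart_at q) q);
  frame_diff_bounded : forall q X i j, Om q ->
    `|dmx (G \o cinv (chart_at q)) (cmap (chart_at q) q) X i j| <= K * `|th q X|;
  frame_struct : forall q X Y, Om q ->
    `|Y *m dmx (frame_mx th (chart_at q)) (cmap (chart_at q) q) X
      - X *m dmx (frame_mx th (chart_at q)) (cmap (chart_at q) q) Y|
      <= K * `|th q X| * `|th q Y| }.

Context {g : metric_field P} {Om : set P} {th : P -> 'rV[R]_N -> 'rV[R]_N}
  {G : P -> 'M[R]_N} {K lam : R} (F : adapted_frame g Om th G K lam).

Lemma frameE k q v : atlas k -> cdom k q ->
  th q v = to_chart k q v *m frame_mx th k (cmap k q).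
Proof.
move=> ak dk.
have H w : th q (of_chart k q w) = w *m frame_mx th k (cmap k q).
  pose LM := GRing.isLinear.Build _ _ _ _ _ (frame_linear F q).
  pose l : {linear 'rV[R]_N -> 'rV[R]_N} := HB.pack (th q) LM.
  pose OM := GRing.isLinear.Build _ _ _ _ _ (@of_chart_lin _ _ _ k q).
  pose o : {linear 'rV[R]_N -> 'rV[R]_N} := HB.pack (of_chart k q) OM.
  rewrite -[LHS]/(l (o w)) [in LHS](row_sum_delta w) !linear_sum.
  apply/rowP => j; rewrite summxE mxE; apply: eq_bigr => i _.
  by rewrite !linearZ /= !mxE cmapK.
by rewrite -H to_chartK.
Qed.

Lemma frame_at q v : th q v = v *m frame_mx th (chart_at q) (cmap (chart_at q) q).
Proof.
rewrite -[v in RHS](@to_chart_at _ _ _ q); apply: frameE.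
  exact: chart_at_atlas.
exact: chart_at_dom.
Qed.

Lemma metric_mx_frame k y : atlas k -> cimg k y -> Om (cinv k y) ->
  metric_mx g k y = frame_mx th k y *m G (cinv k y) *m (frame_mx th k y)^T.
Proof.
move=> ak ky Oy; apply/matrixP => i j.
rewrite mxE /metric_coef (frame_metric F) // /mform.
have R1 (l : 'I_N) : row l (frame_mx th k y) = th (cinv k y) (of_chart k (cinv k y) (basis_vec l)).
  by apply/rowP => j'; rewrite !mxE.
rewrite -!R1 -row_mul.
rewrite tr_row [LHS]mxE [RHS]mxE.
by apply: eq_bigr => h _; rewrite [row _ _ _ _]mxE [col _ _ _ _]mxE.
Qed.

Variable (q : P).
Hypothesis Oq : Om q.
Let k := chart_at q.
Let y0 := cmap k q.
Let Th := frame_mx th k.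

Lemma frame_unit : Th y0 \in unitmx.
Proof.
rewrite -row_free_unit -kermx_eq0; apply/rowV0P => v /sub_kermxP vA.
by apply: (frame_inj F Oq); rewrite frame_at.
Qed.

Let ak : atlas k := chart_at_atlas q.
Let dk : cdom k q := chart_at_dom q.

Lemma near_metric_mx : \forall y \near y0,
  metric_mx g k y = Th y *m (G \o cinv k) y *m (Th y)^T.
Proof.
have nO : nbhs q Om by apply: open_nbhs_nbhs; split=> //; exact: frame_open F.
by apply: filterS2 (near_cimg dk) (near_cinv dk nO) => y ky Oy; exact: metric_mx_frame.
Qed.

Lemma frame_mx_differentiable : mx_differentiable Th y0.
Proof. by move=> i j; apply: C1_at_differentiable; exact: (frame_C1 F). Qed.

Lemma metric_mx_differentiable : mx_differentiable (metric_mx g k) y0.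
Proof.
have h : \forall y \near y0, Th y *m (G \o cinv k) y *m (Th y)^T = metric_mx g k y.
  by apply: filterS near_metric_mx => y ->.
apply: near_mx_differentiable h _.
have dT := frame_mx_differentiable.
apply: mx_differentiable_mul (mx_differentiable_tr dT).
exact: mx_differentiable_mul dT (frame_diff F Oq).
Qed.

Lemma frame_mform_gt0 v : v != 0 -> 0 < mform (G q) v v.
Proof.
move=> v0; apply: lt_le_trans (frame_coercive F _ Oq).
by rewrite mulr_gt0 ?(frame_lam F) // exprn_gt0 // normr_gt0.
Qed.

Lemma metric_mx_unit : metric_mx g k y0 \in unitmx.
Proof.
rewrite (nbhs_singleton near_metric_mx) !unitmx_mul unitmx_tr frame_unit /= andbT.
by rewrite cmapK //; apply: unit_of_posdef; exact: frame_mform_gt0.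
Qed.

Lemma metric_mx_sym : (metric_mx g k y0)^T = metric_mx g k y0.
Proof.
rewrite (nbhs_singleton near_metric_mx) !trmx_mul trmxK /= cmapK //.
by rewrite (frame_sym F Oq) mulmxA.
Qed.

Lemma frame_const_ge0 : 0 <= frame_const N K lam.
Proof.
have K0 := frame_K F; have l0 := frame_lam F.
by rewrite /frame_const divr_ge0 ?mulr_ge0 ?addr_ge0 // ltW // mulr_gt0.
Qed.

(** The vector on the left is minus the covariant derivative of the coframe in
    the direction X, evaluated on Y. Being of the form th Z, as the frame is
    invertible, it can be paired with itself in the Koszul formula; coercivity
    then cancels one factor of its norm. *)
Lemma christoffel_frame_ler X Y :
  `|christoffel_vec g k y0 X Y *m Th y0 - Y *m dmx Th y0 X|
    <= frame_const N K lam * `|th q X| * `|th q Y|.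
Proof.
set zeta := _ - _.
have K0 := frame_K F; have l0 := frame_lam F.
pose Z := zeta *m invmx (Th y0).
have ZE : Z *m Th y0 = zeta by rewrite -mulmxA mulVmx ?frame_unit // mulmx1.
clearbody Z.
have thE v : v *m Th y0 = th q v by rewrite -frame_at.
have GqE : (G \o cinv k) y0 = G q by rewrite /= cmapK.
have sG : ((G \o cinv k) y0)^T = (G \o cinv k) y0 by rewrite GqE; exact: frame_sym F _ Oq.
have e1 := christoffel_koszul X Y Z metric_mx_differentiable metric_mx_sym metric_mx_unit.
have e2 := frame_koszul X Y Z (frame_diff F Oq) frame_mx_differentiable near_metric_mx sG.
rewrite e2 {e2} in e1.
have e3 : mform (metric_mx g k y0) (christoffel_vec g k y0 X Y) Z =
    mform (G q) (christoffel_vec g k y0 X Y *m Th y0) zeta.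
  by rewrite (nbhs_singleton near_metric_mx) GqE /mform -ZE trmx_mul !mulmxA.
rewrite e3 GqE !thE in e1.
have ZE' : th q Z = zeta by rewrite -thE.
rewrite ZE' in e1.
set V := th q X in e1 *; set W := th q Y in e1 *.
set dG := dmx (G \o cinv k) y0 in e1 *.
set cXZ := Z *m _ - _ in e1; set cYZ := Z *m _ - _ in e1; set cXY := Y *m _ - X *m _ in e1.
have bG u v := mform_ler u v (fun i j => frame_bounded F i j Oq).
have bdG S u v : `|mform (dG S) u v| <= N%:R ^+ 2 * (K * `|th q S|) * `|u| * `|v|.
  by apply: mform_ler => i j; exact: (frame_diff_bounded F).
have N0 : 0 <= N%:R ^+ 2 * K :> R by rewrite mulr_ge0.
have b1 : `|mform (G q) W cXZ| <= N%:R ^+ 2 * K * (K * (`|V| * `|W| * `|zeta|)).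
  apply: le_trans (bG _ _) _.
  rewrite -mulrA ler_wpM2l // -ZE' -/V.
  apply: le_trans (ler_wpM2l (normr_ge0 _) (frame_struct F X Z Oq)) _.
  by rewrite -/V le_eqVlt; apply/orP; left; apply/eqP; ring.
have b2 : `|mform (G q) V cYZ| <= N%:R ^+ 2 * K * (K * (`|V| * `|W| * `|zeta|)).
  apply: le_trans (bG _ _) _.
  rewrite -mulrA ler_wpM2l // -ZE'.
  apply: le_trans (ler_wpM2l (normr_ge0 _) (frame_struct F Y Z Oq)) _.
  by rewrite -/W le_eqVlt; apply/orP; left; apply/eqP; ring.
have b3 : `|mform (G q) cXY zeta| <= N%:R ^+ 2 * K * (K * (`|V| * `|W| * `|zeta|)).
  apply: le_trans (bG _ _) _.
  rewrite -mulrA ler_wpM2l //.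
  apply: le_trans (ler_wpM2r (normr_ge0 _) (frame_struct F X Y Oq)) _.
  by rewrite -/V -/W le_eqVlt; apply/orP; left; apply/eqP; ring.
have b4 := bdG X W zeta; have b5 := bdG Y V zeta; have b6 := bdG Z V W.
rewrite -/V in b4; rewrite -/W in b5; rewrite ZE' in b6.
have key : 2 * mform (G q) zeta zeta <= 3 * N%:R ^+ 2 * K * (K + 1) * (`|V| * `|W|) * `|zeta|.
  rewrite {1}/zeta mformBl mulrBr thE e1.
  rewrite [X in X <= _](_ : _ = mform (G q) W cXZ + mform (G q) V cYZ - mform (G q) cXY zeta +
   mform (dG X) W zeta + mform (dG Y) V zeta - mform (dG Z) V W); last by rewrite /zeta; ring.
  apply: le_trans (ler_norm _) _.
  apply: le_trans (ler_normB _ _) _.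
  apply: le_trans (lerD (le_trans (ler_normD _ _) (lerD (le_trans (ler_normD _ _)
    (lerD (le_trans (ler_normB _ _) (lerD (le_trans (ler_normD _ _) (lerD b1 b2)) b3)) b4)) b5)) b6) _.
  by rewrite le_eqVlt; apply/orP; left; apply/eqP; ring.
have lz := frame_coercive F zeta Oq.
have [z0|z0] := eqVneq `|zeta| 0.
  rewrite z0; apply: mulr_ge0 => //; apply: mulr_ge0 => //; exact: frame_const_ge0.
have zp : 0 < `|zeta| by rewrite lt_def z0 normr_ge0.
rewrite /frame_const -!mulrA mulrCA -/V -/W.
(* cancel a factor |zeta| of the quadratic inequality *)
rewrite -(ler_pM2r zp) -(ler_pM2l (_ : 0 < 2 * lam)) ?mulr_gt0 //.
apply: le_trans (le_trans _ key) _.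
  by rewrite -!mulrA ler_pM2l // -expr2.
rewrite le_eqVlt; apply/orP; left; apply/eqP; field.
by rewrite gt_eqF.
Qed.

End AdaptedFrames.

(** * Curves in an adapted frame *)

Section LocalBounds.
Context {R : realType}.

Definition bounded_at {V : normedModType R} (f : R -> V) (t : R) :=
  exists B : R, \forall s \near t, `|f s| <= B.

Lemma continuous_bounded_at {V : normedModType R} (f : R -> V) t :
  {for t, continuous f} -> bounded_at f t.
Proof.
move=> cf; exists (`|f t| + 1).
have h : \forall s \near t, `|f t - f s| < 1 by exact: (cvgrPdist_lt _ _).1 cf 1 ltr01.
apply: filterS h => s fs.
rewrite -(subKr (f t) (f s)) (le_trans (ler_normB _ _)) //.
by rewrite lerD2l ltW.
Qed.

Lemma row_bounded_at {n} (f : R -> 'rV[R]_n) t :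
  (forall i, bounded_at (fun s => f s 0 i) t) -> bounded_at f t.
Proof.
move=> /choice [B Bf]; exists (\sum_i B i).
have h := @filter_forall _ _ (fun i s => `|f s 0 i| <= B i) (nbhs t) _ Bf.
apply: filterS (h _) => s fs; apply: le_trans (row_norm_ler _) _.
exact: ler_sum.
Qed.

End LocalBounds.

Section CurvesInFrames.
Context {R : realType} {N : nat} {P : manifold R N}.

Definition sasaki_speed (g : metric_field P) (c : R -> P) (w : R -> 'rV[R]_N) (t : R) :=
  Num.sqrt (g (c t) (velocity c t) (velocity c t)
    + g (c t) (covariant_derivative g c w t) (covariant_derivative g c w t)).

Context {g : metric_field P} {Om : set P} {th : P -> 'rV[R]_N -> 'rV[R]_N}
  {G : P -> 'M[R]_N} {K lam : R} (F : adapted_frame g Om th G K lam).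
Context {c : R -> P} {w : R -> 'rV[R]_N}.
Hypotheses (sc : smooth_curve c) (sw : smooth_field_along c w).

Let V (s : R) := th (c s) (velocity c s).
Let W (s : R) := th (c s) (w s).
Let D (s : R) := covariant_derivative g c w s.

Lemma near_frame_curve k t : atlas k -> cdom k (c t) ->
  \forall s \near t, to_chart k (c s) (w s) *m frame_mx th k (cmap k (c s)) = W s.
Proof.
move=> ak dk.
by apply: filterS (near_curve sc (near_cdom dk)) => s ds; rewrite /W (frameE F _ ak ds).
Qed.

Lemma frame_mx_curve_C1_at k t i j : atlas k -> cdom k (c t) -> Om (c t) ->
  C1_at (fun s => frame_mx th k (cmap k (c s)) i j) t.
Proof.
move=> ak dk Ot.
apply: (C1_at_comp (f := fun y => frame_mx th k y i j) (g := fun s => cmap k (c s))).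
  by move=> i'; exact: curve_C1_at.
exact: (frame_C1 F).
Qed.

Lemma frame_curve_C1_at t j : Om (c t) -> C1_at (fun s => W s 0 j) t.
Proof.
move=> Ot; have ak := chart_at_atlas (c t); have dk := chart_at_dom (c t).
have h : \forall s \near t, \sum_i to_chart (chart_at (c t)) (c s) (w s) 0 i *
    frame_mx th (chart_at (c t)) (cmap (chart_at (c t)) (c s)) i j = W s 0 j.
  by apply: filterS (near_frame_curve ak dk) => s <-; rewrite mxE.
apply: near_C1_at h _; apply: C1_at_sum => i; apply: C1_at_M.
  exact: field_C1_at.
exact: frame_mx_curve_C1_at.
Qed.

(** In a chart, the derivative of W = Y Th(y) along the curve is Y' Th + Y
    Th', while the covariant derivative has the components (Y' + Gamma) Th;
    the terms with Y' cancel. *)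
Lemma frame_derivative t : Om (c t) ->
  `|th (c t) (D t) - dmx W t 1| <= frame_const N K lam * `|V t| * `|W t|.
Proof.
move=> Ot; set k := chart_at (c t).
have ak : atlas k := chart_at_atlas (c t); have dk : cdom k (c t) := chart_at_dom (c t).
pose A s := to_chart k (c s) (w s); pose B s := frame_mx th k (cmap k (c s)).
have dA : mx_differentiable A t.
  by move=> i j; rewrite (ord1 i); apply: C1_at_differentiable; exact: field_C1_at.
have dB : mx_differentiable B t.
  by move=> i j; apply: C1_at_differentiable; exact: frame_mx_curve_C1_at.
have dW : dmx W t 1 = dmx A t 1 *m B t + A t *m dmx B t 1.
  rewrite -(dmxM (1:R) dA dB); apply/esym; apply: near_dmx (near_frame_curve ak dk) _.
  exact: mx_differentiable_mul.
have At : A t = w t by rewrite /A to_chart_at.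
have dBt : dmx B t 1 = dmx (frame_mx th k) (cmap k (c t)) (velocity c t).
  have dc := curve_diff sc ak dk.
  apply/matrixP => i j; rewrite !mxE velocityE // -/k.
  have d1 := differentiableP dc.
  have d2 := differentiableP (frame_mx_differentiable F Ot i j).
  have [_ e] := is_diff_comp d1 d2.
  exact: (congr1 (fun f => f 1) e).
have DE : D t = dmx A t 1 + christoffel_vec g k (cmap k (c t)) (velocity c t) (w t).
  apply/rowP => i; rewrite !mxE derive1E' //; exact: (dA 0 i).
rewrite dW At dBt (frame_at F) -/k DE mulmxDl -/(B t) opprD addrACA subrr add0r.
exact: (christoffel_frame_ler F Ot).
Qed.

Let S := sasaki_speed g c w.

Lemma metric_ge t v : Om (c t) -> lam * `|th (c t) v| ^+ 2 <= g (c t) v v.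
Proof. by move=> Ot; rewrite (frame_metric F) //; exact: (frame_coercive F). Qed.

Lemma metric_ge0 t v : Om (c t) -> 0 <= g (c t) v v.
Proof.
move=> Ot; apply: le_trans (metric_ge v Ot).
by rewrite mulr_ge0 ?sqr_ge0 // ltW // (frame_lam F).
Qed.

Lemma frame_norm_ler_speed t v : Om (c t) -> g (c t) v v <= S t ^+ 2 ->
  `|th (c t) v| <= S t / Num.sqrt lam.
Proof.
move=> Ot gS; have l0 := frame_lam F.
have sl : 0 < Num.sqrt lam by rewrite sqrtr_gt0.
rewrite ler_pdivlMr // -(ler_pXn2r (n := 2)) ?nnegrE ?mulr_ge0 ?sqrtr_ge0 //.
rewrite exprMn sqr_sqrtr  ?(ltW l0) // mulrC.
exact: le_trans (metric_ge v Ot) gS.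
Qed.

Lemma speed_sqr t : Om (c t) -> S t ^+ 2 =
  g (c t) (velocity c t) (velocity c t) + g (c t) (D t) (D t).
Proof. by move=> Ot; rewrite sqr_sqrtr // addr_ge0 // metric_ge0. Qed.

(** The components of the velocity are bounded by the Sasaki speed, by
    coercivity. *)
Lemma velocity_ler_speed t : Om (c t) -> `|V t| <= S t / Num.sqrt lam.
Proof.
move=> Ot; apply: frame_norm_ler_speed => //.
by rewrite speed_sqr // lerDl metric_ge0.
Qed.

Lemma frame_derivative_ler_speed t : Om (c t) ->
  `|dmx W t 1| <= (1 + frame_const N K lam * `|W t|) * (S t / Num.sqrt lam).
Proof.
move=> Ot.
have h1 : `|th (c t) (D t)| <= S t / Num.sqrt lam.
  by apply: frame_norm_ler_speed => //; rewrite speed_sqr // lerDr metric_ge0.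
have h2 := velocity_ler_speed Ot.
have h3 := frame_derivative Ot.
rewrite -(subKr (th (c t) (D t)) (dmx W t 1)) (le_trans (ler_normB _ _)) //.
rewrite mulrDl mul1r lerD //; apply: le_trans h3 _.
rewrite -mulrA -[leRHS]mulrA [`|W t| * _]mulrC.
by rewrite ler_wpM2l ?(frame_const_ge0 F) // ler_wpM2r.
Qed.

Lemma frame_velocity_bounded_at t : Om (c t) -> bounded_at V t.
Proof.
move=> Ot; set k := chart_at (c t).
have ak : atlas k := chart_at_atlas (c t); have dk : cdom k (c t) := chart_at_dom (c t).
have VE : \forall s \near t, V s = 'd (cmap k \o c) s 1 *m frame_mx th k (cmap k (c s)).
  apply: filterS (near_curve sc (near_cdom dk)) => s ds.
  by rewrite /V (frameE F _ ak ds) to_chart_velocity.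
apply: row_bounded_at => j.
have cV : {for t, continuous (fun s => V s 0 j)}.
  apply: (@near_continuous _ _ (fun s => \sum_i 'd (fun s' => cmap k (c s') 0 i) s 1 * frame_mx th k (cmap k (c s)) i j)).
    apply: filterS2 VE (near_curve sc (near_cdom dk)) => s -> ds; rewrite mxE.
    apply: eq_bigr => i _; congr (_ * _).
    by rewrite -diff_coord //; exact: curve_diff.
  rewrite (_ : (fun _ => _) = \sum_i (fun s => 'd (fun s' => cmap k (c s') 0 i) s 1 * frame_mx th k (cmap k (c s)) i j)); last first.
    by apply/funext => s; rewrite fct_sumE.
  elim/big_ind: _ => [|a b ca cb|i _]; first exact: cst_continuous.
    exact: continuousD.
  apply: continuousM.
    by have [_ +] := curve_C1_at i sc ak dk; exact.
  exact: C1_at_continuous (frame_mx_curve_C1_at i j ak dk Ot).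
exact: continuous_bounded_at cV.
Qed.

(** The length of a step is a real-valued integral, which is 0 when the
    integral of the speed is infinite; the local bound on the speed excludes
    this. *)
Lemma speed_bounded_at t : Om (c t) -> bounded_at S t.
Proof.
move=> Ot.
have [b1 hV] := frame_velocity_bounded_at Ot.
have [b2 hW] : bounded_at W t.
  by apply: row_bounded_at => j; apply: continuous_bounded_at;
     apply: C1_at_continuous; exact: frame_curve_C1_at.
have [b3 hdW] : bounded_at (fun s => dmx W s 1) t.
  apply: row_bounded_at => j; apply: continuous_bounded_at.
  rewrite (_ : (fun _ => _) = (fun s => 'd (fun s' => W s' 0 j) s 1)).
    by have [_] := frame_curve_C1_at j Ot; exact.
  by apply/funext => s; rewrite mxE.
have nO : \forall s \near t, Om (c s).
  apply: near_curve sc _; apply: open_nbhs_nbhs; split=> //; exact: frame_open F.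
have C0 := frame_const_ge0 F.
have K0 := frame_K F.
exists (Num.sqrt (N%:R ^+ 2 * K * b1 ^+ 2 +
   N%:R ^+ 2 * K * (b3 + frame_const N K lam * b1 * b2) ^+ 2)).
near=> s.
have Os : Om (c s) by near: s.
have Vs : `|V s| <= b1 by near: s.
have Ws : `|W s| <= b2 by near: s.
have dWs : `|dmx W s 1| <= b3 by near: s.
rewrite ger0_norm ?sqrtr_ge0 // ler_wsqrtr //.
have ub v (b : R) : `|th (c s) v| <= b -> g (c s) v v <= N%:R ^+ 2 * K * b ^+ 2.
  move=> vb; rewrite (frame_metric F) //.
  apply: le_trans (ler_norm _) _.
  apply: le_trans (mform_ler _ _ (fun i j => frame_bounded F i j Os)) _.
  have b0 : 0 <= b by exact: le_trans (normr_ge0 _) vb.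
  by rewrite -mulrA ler_wpM2l ?mulr_ge0 // -expr2 lerXn2r // nnegrE.
apply: lerD; apply: ub; first exact: Vs.
have h3 := frame_derivative Os.
rewrite -(subrK (dmx W s 1) (th (c s) (covariant_derivative g c w s))).
rewrite addrC (le_trans (ler_normD _ _)) // lerD //.
apply: le_trans h3 _.
by apply: ler_pM => //; [exact: mulr_ge0|apply: ler_pM].
Unshelve. all: by end_near. Qed.

End CurvesInFrames.

(** * Length and variation of a function *)

(** For arbitrary functions, because the integral of a nonnegative function is
    the supremum over the simple functions below it; the Sasaki speed,
    computed in a chart that depends on the point, is used in this way. *)
Lemma ge0_le_integral_mono {d} {T : measurableType d} {R : realType}
    (mu : {measure set T -> \bar R}) (D : set T) (f g : T -> \bar R) :
  (forall x, D x -> (0 <= f x)%E) -> (forall x, D x -> (f x <= g x)%E) ->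
  (\int[mu]_(x in D) f x <= \int[mu]_(x in D) g x)%E.
Proof.
move=> f0 fg.
have g0 x : D x -> (0 <= g x)%E by move=> Dx; apply: le_trans (f0 x Dx) (fg x Dx).
rewrite !ge0_integralE //; apply: le_ereal_sup => _ [h hf <-]; exists h => // x.
apply: le_trans (hf x) _; exact: lee_restrict.
Qed.

Section SpeedIntegral.
Context {R : realType}.

Lemma bounded_at_unit_itv (S : R -> R) : (forall t, bounded_at S t) ->
  exists B : R, forall t, `[0, 1]%classic t -> `|S t| <= B.
Proof.
move=> bS.
have /compact_near_coveringP h := @segment_compact R 0 1.
have := h R (+oo : set_system R) (fun B t => `|S t| <= B) _.
have key : forall x : R, `[0, 1]%classic x ->
    \forall x' \near x & i \near +oo, `|S x'| <= i.
  move=> x _; have [b hb] := bS x.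
  exists ([set x' | `|S x'| <= b], [set i | b <= i]).
    by split=> //=; apply: nbhs_pinfty_ge; exact: num_real.
  by move=> [x' i] /= [h1 h2]; exact: le_trans h1 h2.
move=> /(_ _ key) hB.
have [B hB'] := @filter_ex _ (+oo : set_system R) _ _ hB.
by exists B => t; exact: hB'.
Qed.

(** The fundamental theorem of calculus for h. The boundedness of S makes its
    integral finite, so that comparing integrals in the extended reals gives
    an inequality between real numbers. *)
Lemma variation_ler_integral (h S : R -> R) (L : R) :
  0 < L -> (forall t, C1_at h t) -> (forall t, 0 <= S t) ->
  (forall t, `|'d h t 1| <= L * S t) -> (forall t, bounded_at S t) ->
  h 0 - h 1 <= L * \int[lebesgue_measure]_(t in `[0, 1]) S t.
Proof.
move=> L0 Ch S0 hS bS.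
have dh t : differentiable h t by exact: C1_at_differentiable.
have ch' : continuous (fun t => 'd h t 1 : R) by move=> t; have [_] := Ch t; exact.
have ch x : {for x, continuous h} by exact: differentiable_continuous.
have ftc : (\int[lebesgue_measure]_(t in `[0%R, 1%R]) ('d h t 1)%:E = (h 1)%:E - (h 0)%:E)%E.
  apply: continuous_FTC2 => //.
  - exact: continuous_subspaceT.
  - split.
    + by move=> x _; apply/derivable1_diffP.
    + exact: cvg_at_right_filter (ch 0).
    + exact: cvg_at_left_filter (ch 1).
  - by move=> x _; rewrite derive1E'.
have int : lebesgue_measure.-integrable (`[0, 1]%classic : set R) (EFin \o (fun t => 'd h t 1 : R)).
  apply: continuous_compact_integrable; first exact: segment_compact.
  exact: continuous_subspaceT.
have e1 : h 1 - h 0 = \int[lebesgue_measure]_(t in `[0, 1]) ('d h t 1).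
  by rewrite /Rintegral ftc.
have e2 := @le_normr_Rintegral _ _ _ (@lebesgue_measure R) _ _ (measurable_itv `[0, 1]) int.
rewrite -e1 in e2.
have [B SB] := bounded_at_unit_itv bS.
have fin : (\int[lebesgue_measure]_(t in `[0%R, 1%R]) (S t)%:E < +oo)%E.
  apply: (@le_lt_trans _ _ (\int[lebesgue_measure]_(t in `[0%R, 1%R]) (B)%:E)%E).
    apply: ge0_le_integral_mono => t tI; rewrite lee_fin //.
    exact: le_trans (ler_norm _) (SB t tI).
  rewrite integral_cst /=; last exact: measurable_itv.
  by rewrite lebesgue_measure_itv /= lte_fin ltr01 oppr0 -EFinD -EFinM ltry.
have e3 : \int[lebesgue_measure]_(t in `[0, 1]) (`|'d h t 1|) <= L * \int[lebesgue_measure]_(t in `[0, 1]) S t.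
  rewrite -ler_pdivrMl //.
  have -> : L^-1 * \int[lebesgue_measure]_(t in `[0, 1]) (`|'d h t 1|) =
      \int[lebesgue_measure]_(t in `[0, 1]) (L^-1 * `|'d h t 1|).
    rewrite RintegralZl //.
    exact: (integrable_norm int).
  rewrite /Rintegral; apply: fine_le.
  - rewrite ge0_fin_numE; last first.
      by apply: integral_ge0 => t _; rewrite lee_fin mulr_ge0 // invr_ge0 ltW.
    apply: le_lt_trans fin; apply: ge0_le_integral_mono => t _; rewrite lee_fin.
      by rewrite mulr_ge0 // invr_ge0 ltW.
    by rewrite ler_pdivrMl.
  - by rewrite ge0_fin_numE //; apply: integral_ge0 => t _; rewrite lee_fin.
  - apply: ge0_le_integral_mono => t _; rewrite lee_fin.
      by rewrite mulr_ge0 // invr_ge0 ltW.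
    by rewrite ler_pdivrMl.
apply: le_trans e3; apply: le_trans e2.
by rewrite distrC ler_norm.
Qed.

End SpeedIntegral.

Section Bump.
Context {R : realType}.

(** The square makes the positive part continuously differentiable. *)
Definition bump (s : R) : R := Num.max 0 s ^+ 2.
Definition dbump (s : R) : R := 2 * Num.max 0 s.

Lemma is_derive_bump s : is_derive s (1:R) bump (dbump s).
Proof.
have [s0|s0|<-] := ltgtP 0 s.
- apply: (@near_eq_is_derive _ _ _ (fun x : R => x ^+ 2)).
    near=> x; rewrite /bump max_r // ltW //; near: x; exact: lt_nbhsr.
  split; first exact: exprn_derivable.
  by rewrite exp_derive /dbump max_r ?ltW // /GRing.scale /= mulr1.
- apply: (@near_eq_is_derive _ _ _ (fun x : R => 0)).
    near=> x; rewrite /bump max_l ?expr0n // ltW //; near: x; exact: lt_nbhsl.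
  have -> : dbump s = 0 by rewrite /dbump max_l ?ltW ?mulr0.
  exact: is_derive_cst.
have b0 : dbump 0 = 0 by rewrite /dbump max_l // mulr0.
have cv : (fun h : R => h^-1 *: ((bump \o shift 0) (h *: (1:R)) - bump 0)) @ 0^' --> (0:R).
  apply/cvgrPdist_lt => e e0.
  near=> h.
  have h0 : h != 0 by near: h; exact: nbhs_dnbhs_neq.
  rewrite sub0r normrN /= addr0.
  have -> : bump 0 = 0 by rewrite /bump max_l // expr0n.
  have -> : h *: (1:R) = h by rewrite /GRing.scale /= mulr1.
  rewrite subr0.
  rewrite normrZ normfV ltr_pdivrMl ?normr_gt0 //.
  apply: (@le_lt_trans _ _ (`|h| * `|h|)).
    rewrite normrX expr2; have : `|Num.max 0 h| <= `|h|.
      by case: (leP 0 h) => hh //; rewrite normr0.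
    by move=> hh; apply: ler_pM.
  rewrite ltr_pM2l ?normr_gt0 //; near: h; exact: dnbhs0_lt.
split; first by apply/cvg_ex; exists 0.
rewrite b0; exact: cvg_lim cv.
Unshelve. all: by end_near. Qed.

Lemma continuous_dbump : continuous dbump.
Proof.
have cm : continuous (fun s : R => Num.max 0 s).
  move=> s; apply: (@continuous_max R R (fun=> 0) (fun x => x) s).
    exact: cst_continuous.
  exact: cvg_id.
move=> s; apply: (@continuousM R R (fun=> 2) (fun x => Num.max 0 x) s).
  exact: cst_continuous.
exact: cm.
Qed.

Lemma dbump_ge0 s : 0 <= dbump s.
Proof. by rewrite mulr_ge0 // le_max lexx. Qed.

Lemma dbump_le0 s : s <= 0 -> dbump s = 0.
Proof. by move=> s0; rewrite /dbump max_l // mulr0. Qed.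

Lemma bump_le0 s : s <= 0 -> bump s = 0.
Proof. by move=> s0; rewrite /bump max_l // expr0n. Qed.

Lemma bump1 : bump 1 = 1.
Proof. by rewrite /bump max_r // expr1n. Qed.

End Bump.

(** * A function separating two vectors *)

Section SasakiDistance.
Context {R : realType} {N : nat} {P : manifold R N}.
Implicit Types (g : metric_field P).

Lemma sasaki_chain_ge0 g (x y : P * 'rV[R]_N) l : chain (sasaki_step g) x y l -> 0 <= l.
Proof.
elim=> [|y' z l1 l2 _ l10 [c [w [_ _ _ _ ->]]]]; first by [].
by rewrite addr_ge0 //; apply: Rintegral_ge0 => t _; exact: sqrtr_ge0.
Qed.

Lemma sasaki_dist_refl g (x : P * 'rV[R]_N) : sasaki_dist g x x = 0.
Proof.
apply/eqP; rewrite eq_le; apply/andP; split.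
  apply: ge_inf; last exact: chain_nil.
  by exists 0 => l; exact: sasaki_chain_ge0.
apply: lb_le_inf; first by exists 0; exact: chain_nil.
by move=> l; exact: sasaki_chain_ge0.
Qed.

(** The straight segment in the fiber. This is needed for lower bounds on the
    distance, as the infimum of the empty set is 0. *)
Lemma sasaki_fiber_connected g (p : P) (u v : 'rV[R]_N) :
  exists l, chain (sasaki_step g) (p, u) (p, v) l.
Proof.
pose c : R -> P := fun=> p; pose w (t : R) := u + t *: (v - u).
have aff (k : chart R P N) i : (fun s : R => to_chart k (c s) (w s) 0 i) =
    (fun s => to_chart k p u 0 i + s * to_chart k p (v - u) 0 i).
  by apply/funext => s; rewrite /w /c addrC to_chart_lin !mxE addrC.
have affine_derivable (x y : R) t : infinitely_derivable (fun s : R => x + s * y) t.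
  have d0 s : is_derive s (1:R) (fun s : R => x + s * y) y.
    have h := is_deriveD (is_derive_cst x s (1:R)) (is_deriveM (is_derive_id s (1:R)) (is_derive_cst y s (1:R))).
    by apply: (is_derive_eq h); rewrite /cst /GRing.scale /= mulr0 mulr1 !add0r.
  have e1 : derive1 (fun s : R => x + s * y) = cst y.
    by apply/funext => s; rewrite derive1E; have [_ ->] := d0 s.
  move=> r; case: r => [|r]; first by have [] := d0 t.
  have -> : derive1n r.+1 (fun s : R => x + s * y) = cst (if r is 0 then y else 0).
    elim: r => [|r IH]; first by rewrite derive1nS derive1n0.
    rewrite derive1nS IH; apply/funext => s; by rewrite derive1_cst.
  exact: derivable_cst.
have sc : smooth_curve c.
  split; first exact: cst_continuous.
  move=> k _ t _ i.
  have -> : (fun s => cmap k (c s) 0 i) = (fun s => cmap k p 0 i + s * 0).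
    by apply/funext => s; rewrite mulr0 addr0.
  exact: affine_derivable.
have sw : smooth_field_along c w.
  by move=> k ak t dk i; rewrite aff.
exists (0 + \int[lebesgue_measure]_(t in `[0, 1]) sasaki_speed g c w t).
apply: (chain_rcons (y := (p, u))); first exact: chain_nil.
exists c, w; split=> //; rewrite /c /w.
  by rewrite scale0r addr0.
by rewrite scale1r addrC subrK.
Qed.

End SasakiDistance.

Section BumpOfQuadratic.
Context {R : realType}.

Lemma one_minus_bounds (e u v : R) : e = 1 - u - v -> 0 < e -> 0 <= u -> 0 <= v ->
  [/\ e <= 1, u <= 1 & v <= 1].
Proof. by move=> -> e0 u0 v0; split; lra. Qed.

Lemma C1_at_sum_sqrB {k} (f : 'I_k -> R -> R) (x : 'I_k -> R) (t : R) :
  (forall i, C1_at (f i) t) -> C1_at (fun s => \sum_i (f i s - x i) ^+ 2) t.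
Proof.
move=> Cf; apply: C1_at_sum => i.
have h : C1_at (fun s => f i s - x i) t by exact: C1_at_D (Cf i) (C1_at_cst (- x i) t).
have -> : (fun s => (f i s - x i) ^+ 2) = (fun s => (f i s - x i) * (f i s - x i)).
  by apply/funext => s; rewrite expr2.
exact: C1_at_M.
Qed.

Lemma diff_sum_sqrB {k} (f : 'I_k -> R -> R) (x : 'I_k -> R) (t : R) :
  (forall i, C1_at (f i) t) ->
  'd (fun s => \sum_i (f i s - x i) ^+ 2) t (1:R) =
  \sum_i 2 * (f i t - x i) * 'd (f i) t (1:R).
Proof.
move=> Cf.
have D : is_diff t (\sum_i (fun s : R => (f i s - x i) ^+ 2))
    (\sum_i (fun h : R => 2 * (f i t - x i) * 'd (f i) t h)).
  elim/big_rec2: _ => [|i u v _ IH]; first exact: is_diff_cst.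
  apply: is_diffD => //.
  have df : is_diff t (f i) ('d (f i) t).
    by apply: differentiableP; exact: C1_at_differentiable.
  have dfx := is_diffB df (is_diff_cst (x i) t).
  have [ex val] := is_diffM dfx dfx.
  have e : (fun s : R => (f i s - x i) ^+ 2) = (f i - cst (x i)) * (f i - cst (x i)).
    by apply/funext => s; rewrite expr2.
  rewrite e; split => //; apply: etrans val _; apply/funext => h.
  by rewrite !fctE /cst /GRing.scale /= subr0; ring.
have e : (fun s => \sum_i (f i s - x i) ^+ 2) = \sum_i (fun s : R => (f i s - x i) ^+ 2).
  by apply/funext => s; rewrite fct_sumE.
have [_ val] := D.
by rewrite e; apply: etrans (congr1 (fun g => g (1:R)) val) _; rewrite fct_sumE.
Qed.

Lemma diff_bump_comp (f : R -> R) (t : R) : differentiable f t ->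
  'd (fun s => bump (f s)) t (1:R) = dbump (f t) * 'd f t (1:R).
Proof.
move=> df; have [d1 v1] := is_derive_bump (f t).
have db : differentiable bump (f t) by apply/derivable1_diffP.
have [_ val] := is_diff_comp (differentiableP df) (differentiableP db).
apply: etrans (congr1 (fun g => g (1:R)) val) _.
apply: etrans (congr1 (fun g => g ('d f t (1:R))) (deriv1E d1)) _.
by rewrite derive1E v1 /GRing.scale /= mulrC.
Qed.

(** From 2 |x| <= 1 + x ^ 2. *)
Lemma sum_sqr_entry {k} (s : R) (f : 'I_k -> R) i :
  0 < s -> s * (\sum_i f i ^+ 2) <= 1 -> s * (2 * `|f i|) <= s + 1.
Proof.
move=> s0 h.
have h1 : s * f i ^+ 2 <= 1.
  apply: le_trans h; rewrite ler_pM2l // (bigD1 i) //= lerDl.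
  by apply: sumr_ge0 => j _; exact: sqr_ge0.
have : 2 * `|f i| <= 1 + f i ^+ 2.
  by rewrite -[f i ^+ 2]real_normK ?num_real //; have := sqr_ge0 (`|f i| - 1); rewrite sqrrB1; lra.
by rewrite -(ler_pM2l s0) mulrDr mulr1; lra.
Qed.

Lemma weighted_sum_ler {k} (s A : R) (f d : 'I_k -> R) :
  0 < s -> s * (\sum_i f i ^+ 2) <= 1 -> (forall i, `|d i| <= A) ->
  `|s * \sum_i 2 * f i * d i| <= (s + 1) * k%:R * A.
Proof.
move=> s0 h hd.
rewrite mulr_sumr; apply: le_trans (ler_norm_sum _ _ _) _.
apply: (@le_trans _ _ (\sum_(i < k) ((s + 1) * A))).
  apply: ler_sum => i _; rewrite mulrA normrM ler_pM //.
  rewrite !normrM (gtr0_norm s0) ger0_norm //.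
  exact: sum_sqr_entry.
by rewrite sumr_const card_ord -[leLHS]mulr_natl mulrCA mulrA.
Qed.

(** Where the bump is not zero both quadratic terms are at most 1, which
    bounds the factors X - x and W - w of the derivative; elsewhere the
    derivative vanishes. *)
Lemma bump_quadratic_derivative {k l} (X : 'I_k -> R -> R) (x : 'I_k -> R)
    (W : 'I_l -> R -> R) (w : 'I_l -> R) (a b A B t : R) :
  0 < a -> 0 < b -> 0 <= A -> 0 <= B ->
  (forall i, C1_at (X i) t) -> (forall j, C1_at (W j) t) ->
  (forall i, `|'d (X i) t (1:R)| <= A) ->
  (b * (\sum_j (W j t - w j) ^+ 2) <= 1 -> forall j, `|'d (W j) t (1:R)| <= B) ->
  `|'d (fun s => bump (1 + (- a) * (\sum_i (X i s - x i) ^+ 2)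
      + (- b) * (\sum_j (W j s - w j) ^+ 2))) t (1:R)| <=
  2 * ((a + 1) * k%:R * A + (b + 1) * l%:R * B).
Proof.
move=> a0 b0 A0 B0 CX CW dX dW.
have rhs0 : 0 <= 2 * ((a + 1) * k%:R * A + (b + 1) * l%:R * B).
  have a1 : 0 <= a + 1 by rewrite addr_ge0 // ltW.
  have b1 : 0 <= b + 1 by rewrite addr_ge0 // ltW.
  by apply: mulr_ge0 => //; apply: addr_ge0; rewrite !mulr_ge0.
set sX := fun s => \sum_i (X i s - x i) ^+ 2.
set sW := fun s => \sum_j (W j s - w j) ^+ 2.
have CsX : C1_at sX t := C1_at_sum_sqrB x CX.
have CsW : C1_at sW t := C1_at_sum_sqrB w CW.
set e := fun s => 1 + (- a) * sX s + (- b) * sW s.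
have [de vale] := is_diffD (is_diffD (is_diff_cst (1:R) t)
    (is_diffZ (- a) (differentiableP (C1_at_differentiable CsX))))
    (is_diffZ (- b) (differentiableP (C1_at_differentiable CsW))).
have {}de : differentiable e t by exact: de.
have eE : 'd e t (1:R) = - (a * 'd sX t (1:R)) - b * 'd sW t (1:R).
  apply: etrans (congr1 (fun f => f (1:R)) vale) _.
  by rewrite !fctE /GRing.scale /= add0r !mulNr.
rewrite diff_bump_comp //.
have [e0|e0] := leP (e t) 0; first by rewrite dbump_le0 // mul0r normr0.
have sX0 : 0 <= a * sX t.
  by apply: mulr_ge0; [exact: ltW|apply: sumr_ge0 => i _; exact: sqr_ge0].
have sW0 : 0 <= b * sW t.
  by apply: mulr_ge0; [exact: ltW|apply: sumr_ge0 => i _; exact: sqr_ge0].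
have etE : e t = 1 - a * sX t - b * sW t by rewrite /e !mulNr.
have [e1 aX bW] : [/\ e t <= 1, a * sX t <= 1 & b * sW t <= 1].
  exact: one_minus_bounds etE e0 sX0 sW0.
rewrite normrM; apply: ler_pM => //.
  rewrite ger0_norm ?dbump_ge0 // /dbump (max_r (ltW e0)).
  by rewrite -[leRHS]mulr1 ler_pM2l.
rewrite eE (le_trans (ler_normB _ _)) // normrN lerD //.
  rewrite /sX diff_sum_sqrB //; exact: weighted_sum_ler.
rewrite /sW diff_sum_sqrB //; apply: weighted_sum_ler => //; exact: dW.
Qed.

End BumpOfQuadratic.

(** The bound of [bump_quadratic_derivative] with the estimates of
    [velocity_ler_speed] and [frame_derivative_ler_speed]; on the support of
    the bump, |W| <= w0 + 1 + 1 / b. The summand 1 makes the constant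
    positive. *)
Definition separator_lipschitz {R : realType} (n N : nat) (K lam a b w0 : R) : R :=
  2 * ((a + 1) * n%:R
    + (b + 1) * N%:R * (1 + frame_const N K lam * (w0 + (1 + b^-1)))) / Num.sqrt lam + 1.

Section Separator.
Context {R : realType} {n N : nat} {P : manifold R N}.
Context {g : metric_field P} {Om : set P} {th : P -> 'rV[R]_N -> 'rV[R]_N}
  {G : P -> 'M[R]_N} {K lam : R} (F : adapted_frame g Om th G K lam).
Variable xi : P -> 'rV[R]_n.
Hypothesis xi_C1 : forall c t i, smooth_curve c -> Om (c t) ->
  C1_at (fun s => xi (c s) 0 i) t.
Hypothesis xi_speed : forall c t i, smooth_curve c -> Om (c t) ->
  `|'d (fun s => xi (c s) 0 i) t 1| <= `|th (c t) (velocity c t)|.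
Hypothesis speed_bounded : forall c w, smooth_curve c -> smooth_field_along c w ->
  forall t, bounded_at (sasaki_speed g c w) t.
Variables (z0 : 'rV[R]_n) (W0 : 'rV[R]_N) (a b w0 : R).
Hypotheses (a0 : 0 < a) (b0 : 0 < b) (W0w0 : `|W0| <= w0).
Hypothesis exit : forall q, ~ Om q -> \forall q' \near q, Om q' ->
  1 <= a * \sum_i (xi q' 0 i - z0 0 i) ^+ 2.

Definition separator_arg (q : P) (v : 'rV[R]_N) : R :=
  1 + (- a) * \sum_i (xi q 0 i - z0 0 i) ^+ 2
    + (- b) * \sum_j (th q v 0 j - W0 0 j) ^+ 2.

(** By the hypothesis [exit] the bump vanishes near the complement of Om, so
    that the extension by zero stays continuously differentiable along curves. *)
Definition separator (x : P * 'rV[R]_N) : R :=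
  if `[< Om x.1 >] then bump (separator_arg x.1 x.2) else 0.

Let L : R := separator_lipschitz n N K lam a b w0.

Lemma separator_lipschitz_gt0 : 0 < L.
Proof.
rewrite /L /separator_lipschitz ltr_wpDl // divr_ge0 ?sqrtr_ge0 // mulr_ge0 //.
have C0 := frame_const_ge0 F.
have bi : 0 <= b^-1 by rewrite invr_ge0 ltW.
have a1 : 0 <= a + 1 by rewrite addr_ge0 // ltW.
have b1 : 0 <= b + 1 by rewrite addr_ge0 // ltW.
have w00 : 0 <= w0 := le_trans (normr_ge0 _) W0w0.
have W1 : 0 <= w0 + (1 + b^-1) by rewrite !addr_ge0.
by apply: addr_ge0; rewrite !mulr_ge0 // addr_ge0 // mulr_ge0.
Qed.

Section AlongCurve.
Variables (c : R -> P) (w : R -> 'rV[R]_N).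
Hypotheses (sc : smooth_curve c) (sw : smooth_field_along c w).

Let X i s := xi (c s) 0 i.
Let W j s := th (c s) (w s) 0 j.

Lemma near_Om t : Om (c t) -> \forall s \near t, Om (c s).
Proof.
move=> Ot.
have nO : nbhs (c t) Om by apply: open_nbhs_nbhs; split=> //; exact: frame_open F.
exact: near_curve sc nO.
Qed.

Lemma near_separator t : Om (c t) ->
  \forall s \near t, bump (separator_arg (c s) (w s)) = separator (c s, w s).
Proof. by move=> /near_Om; apply: filterS => s Os; rewrite /separator /= asboolT. Qed.

Lemma separator_arg_C1_at t : Om (c t) -> C1_at (fun s => separator_arg (c s) (w s)) t.
Proof.
move=> Ot; apply: C1_at_D; first (apply: C1_at_D; first exact: C1_at_cst).
  apply: C1_at_Z; apply: (C1_at_sum_sqrB (f := X)) => i; exact: xi_C1.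
apply: C1_at_Z; apply: (C1_at_sum_sqrB (f := W)) => j.
exact: (frame_curve_C1_at F sc sw).
Qed.

Lemma near_separator0 t : ~ Om (c t) -> \forall s \near t, 0 = separator (c s, w s).
Proof.
move=> nO.
have h : \forall s \near t, Om (c s) -> 1 <= a * \sum_i (xi (c s) 0 i - z0 0 i) ^+ 2.
  exact: near_curve sc (exit nO).
apply: filterS h => s h; rewrite /separator /=; case: asboolP => // /h h1.
apply/esym/bump_le0; rewrite /separator_arg !mulNr.
have h2 : 0 <= b * \sum_j (th (c s) (w s) 0 j - W0 0 j) ^+ 2.
  by apply: mulr_ge0; [exact: ltW|apply: sumr_ge0 => j _; exact: sqr_ge0].
by move: h1 h2; set u := a * _; set v := b * _ => h1 h2; lra.
Qed.

Lemma separator_C1_at t : C1_at (fun s => separator (c s, w s)) t.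
Proof.
have [Ot|nO] := pselect (Om (c t)).
  apply: near_C1_at (near_separator Ot) _.
  apply: (C1_at_compR is_derive_bump continuous_dbump).
  exact: separator_arg_C1_at.
exact: near_C1_at (near_separator0 nO) (C1_at_cst 0 t).
Qed.

Let S := sasaki_speed g c w.

Lemma separator_derivative t : `|'d (fun s => separator (c s, w s)) t (1:R)| <= L * S t.
Proof.
have S0 : 0 <= S t by exact: sqrtr_ge0.
have L0 := separator_lipschitz_gt0.
have triv : 0 <= L * S t by rewrite mulr_ge0 // ltW.
have [Ot|nO] := pselect (Om (c t)); last first.
  rewrite (near_diff (near_separator0 nO)); last exact: differentiable_cst.
  by rewrite [X in `|X (_ : R)|](diff_cst (0:R)) normr0.
have dbe : differentiable (fun s => bump (separator_arg (c s) (w s))) t.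
  apply: C1_at_differentiable; apply: (C1_at_compR is_derive_bump continuous_dbump).
  exact: separator_arg_C1_at.
rewrite (near_diff (near_separator Ot) dbe).
have C0 := frame_const_ge0 F.
have bi : 0 <= b^-1 by rewrite invr_ge0 ltW.
have Sl : 0 <= S t / Num.sqrt lam by rewrite divr_ge0 // sqrtr_ge0.
have w00 : 0 <= w0 := le_trans (normr_ge0 _) W0w0.
set B := 1 + frame_const N K lam * (w0 + (1 + b^-1)).
have B0 : 0 <= B by rewrite addr_ge0 // mulr_ge0 // !addr_ge0.
have bq := @bump_quadratic_derivative R n N X (fun i => z0 0 i) W (fun j => W0 0 j)
  a b (S t / Num.sqrt lam) (B * (S t / Num.sqrt lam)) t a0 b0 Sl.
apply: le_trans (bq _ _ _ _ _) _.
- exact: mulr_ge0.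
- by move=> i; exact: xi_C1.
- by move=> j; exact: (frame_curve_C1_at F sc sw).
- move=> i; apply: le_trans (xi_speed i sc Ot) _.
  exact: (velocity_ler_speed F).
- move=> bW j.
  have -> : 'd (W j) t (1:R) = dmx (fun s => th (c s) (w s)) t (1:R) 0 j by rewrite mxE.
  apply: le_trans (coord_ler _ _) _.
  apply: le_trans (frame_derivative_ler_speed F sc sw Ot) _.
  rewrite ler_wpM2r // lerD2l ler_wpM2l //.
  rewrite -(subrK W0 (th (c t) (w t))) addrC (le_trans (ler_normD _ _)) // lerD //.
  apply: row_norm_le => [|i]; first by rewrite addr_ge0.
  rewrite !mxE.
  have h' := sum_sqr_entry (f := fun j => th (c t) (w t) 0 j - W0 0 j) i b0 bW.
  rewrite -(ler_pM2l b0) mulrDr mulr1 mulfV ?gt_eqF //.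
  by apply: le_trans h'; rewrite ler_pM2l // mulr_natl mulr2n lerDl.
rewrite /L /separator_lipschitz -/B [leRHS]mulrDl mul1r -[leLHS]addr0; apply: lerD => //.
by rewrite le_eqVlt; apply/orP; left; apply/eqP; ring.
Qed.

End AlongCurve.

Lemma separator_step (x y : P * 'rV[R]_N) l : sasaki_step g x y l ->
  separator x - separator y <= L * l.
Proof.
move=> [c [w [sc sw <- <- ->]]].
apply: (variation_ler_integral (h := fun s => separator (c s, w s)) (S := sasaki_speed g c w)).
- exact: separator_lipschitz_gt0.
- exact: separator_C1_at.
- by move=> t; exact: sqrtr_ge0.
- exact: separator_derivative.
- exact: speed_bounded.
Qed.

Lemma separator_chain (x y : P * 'rV[R]_N) l : chain (sasaki_step g) x y l ->
  separator x - separator y <= L * l.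
Proof.
elim=> [|y' z l1 l2 _ IH st]; first by rewrite subrr mulr0.
by rewrite -(subrKA (separator y')) mulrDr lerD //; exact: separator_step.
Qed.

Lemma separator_sasaki_dist (p : P) (u v : 'rV[R]_N) :
  (separator (p, u) - separator (p, v)) / L <= sasaki_dist g (p, u) (p, v).
Proof.
apply: lb_le_inf; first exact: sasaki_fiber_connected.
move=> l /= ch; rewrite ler_pdivrMr ?separator_lipschitz_gt0 // mulrC.
exact: separator_chain.
Qed.

End Separator.

(** * Connections in a local trivialization *)

Lemma is_diff_row_mx {R : realType} {V : normedModType R} {p q}
    (f : V -> 'rV[R]_p) (g : V -> 'rV[R]_q) (x : V) (df : V -> 'rV[R]_p)
    (dg : V -> 'rV[R]_q) :
  is_diff x f df -> is_diff x g dg ->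
  is_diff x (fun y => row_mx (f y) (g y)) (fun v => row_mx (df v) (dg v)).
Proof.
move=> [df' <-] [dg' <-].
have D j : is_diff x (fun y => row_mx (f y) (g y) 0 j) (fun v => row_mx ('d f x v) ('d g x v) 0 j).
  rewrite -(splitK j); case: (fintype.split j) => i /=.
    have -> : (fun y => row_mx (f y) (g y) 0 (lshift q i)) = (fun y => f y 0 i).
      by apply/funext => y; rewrite row_mxEl.
    have -> : (fun v => row_mx ('d f x v) ('d g x v) 0 (lshift q i)) = (fun v => 'd f x v 0 i).
      by apply/funext => y; rewrite row_mxEl.
    exact: is_diff_coord.
  have -> : (fun y => row_mx (f y) (g y) 0 (rshift p i)) = (fun y => g y 0 i).
    by apply/funext => y; rewrite row_mxEr.
  have -> : (fun v => row_mx ('d f x v) ('d g x v) 0 (rshift p i)) = (fun v => 'd g x v 0 i).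
    by apply/funext => y; rewrite row_mxEr.
  exact: is_diff_coord.
have dF : differentiable (fun y => row_mx (f y) (g y)) x.
  by apply: differentiable_row => j; have [] := D j.
split=> //; apply/funext => v; apply/rowP => j.
by rewrite -diff_coord //; have [_ ->] := D j.
Qed.

Section Trivialization.
Context {R : realType} {n m : nat} {M : manifold R n} {P : manifold R (n + m)}.
Variables (pi : P -> M) (act : P -> 'rV[R]_m -> P).
Hypothesis pi_smooth : smooth_map_on setT pi.
Hypothesis act_free : free_torus_action act.
Hypothesis act_smooth : smooth_action act.
Variables (U : set M) (s : M -> P) (W : set P) (tau : P -> 'rV[R]_m).
Hypothesis oU : open U.
Hypothesis s_smooth : smooth_map_on U s.
Hypothesis oW : open W.
Hypothesis WU : W `<=` pi @^-1` U.
Hypothesis tau_smooth : smooth_vec_on W tau.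
Hypothesis tauE : forall q, W q -> q = act (s (pi q)) (tau q).

(** The fundamental vector field of the action. *)
Definition fiber_velocity (q : P) (xi : 'rV[R]_m) :=
  velocity (fun r : R => act q (r *: xi)) 0.

Lemma smooth_vec_diff c q : atlas c -> cdom c q -> W q ->
  differentiable (tau \o cinv c) (cmap c q).
Proof.
move=> ac dq Wq; apply: differentiable_row => j.
have /= [h _] := tau_smooth ac 1 j.
by apply: h; exists q.
Qed.

Lemma act_diff (b : P) (t : 'rV[R]_m) c c' :
  atlas c -> atlas c' -> cdom c b -> cdom c' (act b t) ->
  differentiable (fun y : 'rV[R]_(n + m + m) =>
    cmap c' (act (cinv c (lsubmx y)) (rsubmx y))) (row_mx (cmap c b) t).
Proof.
move=> ac ac' db dt; apply: differentiable_row => j.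
have /= [h _] := act_smooth.2 c c' ac ac' 1 j.
apply: h => /=; rewrite row_mxKl row_mxKr cmapK //.
by split=> //; exact: cimg_cmap.
Qed.

(** The differential of q = s(pi q).tau(q): the first term moves the point of
    the section, the second one moves along the fiber. *)
Lemma tangent_decomposition q v : W q ->
  let xi := 'd (tau \o cinv (chart_at q)) (cmap (chart_at q) q) v in
  v = tangent_map (act^~ (tau q)) (s (pi q))
        (tangent_map s (pi q) (tangent_map pi q v))
      + fiber_velocity q xi.
Proof.
move=> Wq xi; set b := s (pi q); set t := tau q; set k := chart_at q.
set l := chart_at (pi q); set kb := chart_at b.
have qE : act b t = q by rewrite -tauE.
have [ak dk] : atlas k /\ cdom k q by split; [exact: chart_at_atlas|exact: chart_at_dom].
have [al dl] : atlas l /\ cdom l (pi q) by split; [exact: chart_at_atlas|exact: chart_at_dom].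
have [ab db] : atlas kb /\ cdom kb b by split; [exact: chart_at_atlas|exact: chart_at_dom].
pose F (y : 'rV[R]_(n + m + m)) := cmap k (act (cinv kb (lsubmx y)) (rsubmx y)).
set y0 := row_mx (cmap kb b) t.
have dF : differentiable F y0 by apply: act_diff => //; rewrite qE.
pose h z := cmap kb (s (pi (cinv k z))).
set a := tangent_map s (pi q) (tangent_map pi q v).
have Uq : U (pi q) := WU Wq.
have dpi : differentiable (cmap l \o pi \o cinv k) (cmap k q).
  by apply: (smooth_map_diff pi_smooth).
have ds : differentiable (cmap kb \o s \o cinv l) (cmap l (pi q)).
  exact: (smooth_map_diff s_smooth).
have npi : \forall z \near cmap k q, cdom l (pi (cinv k z)).
  apply: (near_cinv (A := pi @^-1` cdom l) dk).
  by apply: (pi_smooth.1 q I); exact: near_cdom.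
have dh : is_diff (cmap k q) h
    ('d (cmap kb \o s \o cinv l) (cmap l (pi q)) \o 'd (cmap l \o pi \o cinv k) (cmap k q)).
  have d1 := differentiableP dpi.
  have d2 : is_diff ((cmap l \o pi \o cinv k) (cmap k q)) (cmap kb \o s \o cinv l)
    ('d (cmap kb \o s \o cinv l) (cmap l (pi q))).
    by rewrite /= cmapK //; exact: differentiableP.
  apply: near_is_diff (is_diff_comp d1 d2).
  by apply: filterS npi => z dz; rewrite /= cmapK.
have dtau := differentiableP (smooth_vec_diff ak dk Wq).
have dH := is_diff_row_mx dh dtau.
have dF' : is_diff (row_mx (h (cmap k q)) ((tau \o cinv k) (cmap k q))) F ('d F y0).
  by rewrite /h /= cmapK //; exact: differentiableP.
have [_ FH] := is_diff_comp dH dF'.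
have [_ idE] : is_diff (cmap k q) (fun z => F (row_mx (h z) ((tau \o cinv k) z))) id.
  apply: near_is_diff (is_diff_id _).
  have nW : nbhs q W by exact: open_nbhs_nbhs.
  have ns : \forall q' \near q, cdom kb (s (pi q')).
    have sc := s_smooth.1 _ Uq.
    exact: (continuous_comp (pi_smooth.1 q I) sc (near_cdom db)).
  apply: filterS3 (near_cinv dk nW) (near_cimg dk) (near_cinv dk ns) => z Wz kz sz.
  by rewrite /F /h row_mxKl row_mxKr /= cmapK // -tauE // cinvK.
have vE : v = 'd F y0 (row_mx a xi).
  have := congr1 (fun f => f v) (etrans (esym idE) FH).
  by [].
rewrite {1}vE.
have -> : row_mx a xi = row_mx a 0 + row_mx 0 xi by rewrite add_row_mx addr0 add0r.
rewrite linearD; congr (_ + _).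
  have d1 := is_diff_row_mx (is_diff_id (cmap kb b)) (is_diff_cst t (cmap kb b)).
  have d2 : is_diff (row_mx (cmap kb b) (cst t (cmap kb b))) F ('d F y0) by exact: differentiableP.
  have [_ e] := is_diff_comp d1 d2.
  rewrite /tangent_map qE.
  transitivity (('d F y0 \o (fun v0 => row_mx v0 ((0 : 'rV[R]_(n+m) -> 'rV[R]_m) v0))) a).
    by [].
  rewrite -e; congr ('d _ _ a).
  by apply/funext => z; rewrite /F /= row_mxKl row_mxKr.
have d1 : is_diff (0:R) (fun r : R => t + r *: xi) (fun r => r *: xi).
  have [ex val] := is_diffD (is_diff_cst t (0:R)) (is_diff_scalel (0:R) xi).
  split; first exact: ex.
  by apply: etrans val _; rewrite add0r.
have d2 := is_diff_row_mx (is_diff_cst (cmap kb b) (0:R)) d1.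
have d3 : is_diff (row_mx (cst (cmap kb b) (0:R)) (t + (0:R) *: xi)) F ('d F y0).
  by rewrite scale0r addr0; exact: differentiableP.
have [dx e] := is_diff_comp d2 d3.
have [act0 actD _] := act_free.
have FE : F \o (fun r : R => row_mx (cst (cmap kb b) r) (t + r *: xi)) =
    (fun r : R => cmap k (act q (r *: xi))).
  apply/funext => r; rewrite /F /= row_mxKl row_mxKr cmapK //.
  by rewrite -actD qE.
rewrite FE in dx e.
rewrite /fiber_velocity; apply/rowP => i; rewrite mxE scale0r act0 -/k.
have dxi := is_diff_coord i dx.
rewrite derive1E'; last exact: ex_diff.
have [_ ->] := dxi.
rewrite e /= scale1r //.
Qed.

Variable omega : P -> 'rV[R]_(n + m) -> 'rV[R]_m.
Hypothesis omega_conn : connection_form act omega.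

(** Apply omega to [tangent_decomposition]. As the torus is abelian, the
    equivariance of omega has no adjoint factor, and the local form of omega
    is dtau + pi^* (s^* omega). *)
Lemma connection_decomposition q v : W q ->
  omega q v = omega (s (pi q)) (tangent_map s (pi q) (tangent_map pi q v))
    + 'd (tau \o cinv (chart_at q)) (cmap (chart_at q) q) v.
Proof.
move=> Wq; have [lin _ vert equi] := omega_conn.
have om_add p u w : omega p (u + w) = omega p u + omega p w.
  by rewrite -[u in LHS]scale1r lin scale1r.
rewrite {1}(tangent_decomposition v Wq) om_add; congr (_ + _).
  by rewrite [in X in omega X _](tauE Wq) equi.
exact: vert.
Qed.

(** A vector killed by the projection is vertical by [tangent_decomposition],
    and omega reads off its generator. *)
Lemma connection_injective q v : W q ->
  tangent_map pi q v = 0 -> omega q v = 0 -> v = 0.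
Proof.
move=> Wq v0 ov0; have [lin _ vert equi] := omega_conn.
have s0 : tangent_map s (pi q) 0 = 0 by rewrite /tangent_map linear0.
have om0 p : omega p 0 = 0.
  by have := lin p (-1) 0 0; rewrite scaler0 addr0 scaleN1r addNr.
have := connection_decomposition v Wq.
rewrite v0 s0 om0 add0r ov0 => xi0.
have := tangent_decomposition v Wq; rewrite /= -xi0 v0 s0 /tangent_map linear0 add0r => ->.
have [act0 _ _] := act_free.
apply/rowP => i; rewrite !mxE.
rewrite (_ : (fun _ => _) = cst (cmap (chart_at (act q (0 *: 0))) q 0 i)).
  by rewrite derive1_cst.
by apply/funext => r /=; rewrite !scaler0 act0.
Qed.

End Trivialization.

(** * Local bounds and exterior derivatives *)

Section NearBounds.
Context {R : realType} {V : normedModType R}.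

Lemma near_bounded_fin {I : finType} (f : I -> V -> R) (x : V) :
  (forall i, {for x, continuous (f i)}) ->
  exists2 K : R, 0 <= K & \forall y \near x, forall i, `|f i y| <= K.
Proof.
move=> cf; exists (\sum_i (`|f i x| + 1)).
  by apply: sumr_ge0 => i _; rewrite addr_ge0.
have h i : \forall y \near x, `|f i x - f i y| < 1.
  by exact: (cvgrPdist_lt _ _).1 (cf i) 1 ltr01.
have hh := @filter_forall _ _ (fun i y => `|f i x - f i y| < 1) (nbhs x) _ h.
apply: filterS (hh _) => y fy i; rewrite (bigD1 i) //= -[leLHS]addr0 lerD //.
  rewrite -(subKr (f i x) (f i y)) (le_trans (ler_normB _ _)) // lerD2l.
  exact: ltW.
by apply: sumr_ge0 => j _; rewrite addr_ge0.
Qed.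

End NearBounds.

Section Coercivity.
Context {R : realType} {N : nat}.

Lemma mform_continuous (A : 'M[R]_N) : continuous (fun v : 'rV[R]_N => mform A v v).
Proof.
move=> v.
have -> : (fun v : 'rV[R]_N => mform A v v) =
    \sum_j \sum_i (fun v : 'rV[R]_N => v 0 i * A i j * v 0 j).
  apply/funext => w; rewrite mformE fct_sumE; apply: eq_bigr => j _.
  by rewrite fct_sumE.
elim/big_ind: _ => [|a b ca cb|j _]; [exact: (@cst_continuous _ _ (0:R))|exact: continuousD|].
elim/big_ind: _ => [|a b ca cb|i _]; [exact: (@cst_continuous _ _ (0:R))|exact: continuousD|].
have cc l : {for v, continuous (fun v : 'rV[R]_N => v 0 l : R)}.
  by apply: differentiable_continuous; exact: differentiable_coord.
have cA : {for v, continuous (fun v : 'rV[R]_N => A i j : R)} by exact: cst_continuous.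
exact: (continuousM (continuousM (cc i) cA) (cc j)).
Qed.

(** The minimum of the form on the unit sphere. *)
Lemma posdef_coercive (A : 'M[R]_N) : (forall v, v != 0 -> 0 < mform A v v) ->
  exists2 mu : R, 0 < mu & forall v, mu * `|v| ^+ 2 <= mform A v v.
Proof.
move=> pA.
pose Sph := [set v : 'rV[R]_N | `|v| = 1].
have scale (mu : R) : (forall v, Sph v -> mu <= mform A v v) ->
    forall v, mu * `|v| ^+ 2 <= mform A v v.
  move=> h v; have [->|v0] := eqVneq v 0.
    by rewrite normr0 expr0n mulr0 /mform mul0mx mul0mx mxE.
  have nv : 0 < `|v| by rewrite normr_gt0.
  have := h (`|v|^-1 *: v); rewrite /Sph /= normrZ normfV normr_id mulVf ?gt_eqF //.
  move=> /(_ erefl); have -> : mform A (`|v|^-1 *: v) (`|v|^-1 *: v) = mform A v v / `|v| ^+ 2.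
    rewrite mformZl -[`|v|^-1 *: v]addr0 mformPr {2}/mform trmx0 mulmx0 mxE addr0.
    by rewrite mulrA -expr2 exprVn mulrC.
  by rewrite ler_pdivlMr // exprn_gt0.
have [[v0 Sv0]|noS] := pselect (Sph !=set0); last first.
  by exists 1 => //; apply: scale => v Sv; case: noS; exists v.
have cS : compact Sph.
  apply: bounded_closed_compact.
    by exists 1; split=> // M M1 v /= ->; exact: ltW.
  have -> : Sph = (fun v : 'rV[R]_N => `|v|) @^-1` [set 1] by [].
  by apply: closed_comp => [v _|]; [exact: norm_continuous|exact: closed_eq].
have [|c cSph cmin] := EVT_min_rV (f := fun v => mform A v v) (ex_intro _ v0 Sv0) cS.
  by apply: continuous_subspaceT; exact: mform_continuous.
move: cSph; rewrite inE => cSph.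
exists (mform A c c).
  by apply: pA; rewrite -normr_eq0 cSph oner_eq0.
by apply: scale => v Sv; apply: cmin; rewrite inE.
Qed.

(** Half of the coercivity constant at x absorbs a small perturbation of the
    entries. *)
Lemma posdef_coercive_near {V : normedModType R} (G : V -> 'M[R]_N) (x : V) :
  (forall i j, {for x, continuous (fun y => G y i j)}) ->
  (forall v, v != 0 -> 0 < mform (G x) v v) ->
  exists2 lam : R, 0 < lam &
    \forall y \near x, forall v, lam * `|v| ^+ 2 <= mform (G y) v v.
Proof.
move=> cG pG; have [mu mu0 hmu] := posdef_coercive pG.
pose N1 : R := N%:R ^+ 2 + 1.
have N10 : 0 < N1 by rewrite ltr_wpDl // exprn_ge0.
pose d := mu / 2 / N1.
have d0 : 0 < d by rewrite !divr_gt0.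
have h (ij : 'I_N * 'I_N) : \forall y \near x, `|G x ij.1 ij.2 - G y ij.1 ij.2| < d.
  by exact: (cvgrPdist_lt _ _).1 (cG ij.1 ij.2) d d0.
have hh := @filter_forall _ _ (fun ij y => `|G x ij.1 ij.2 - G y ij.1 ij.2| < d) (nbhs x) _ h.
exists (mu / 2); first by rewrite divr_gt0.
apply: filterS (hh _) => y Gy v.
have dG i j : `|(G x - G y) i j| <= d by rewrite !mxE; exact: ltW (Gy (i, j)).
have b := mform_ler v v dG.
have e : mform (G y) v v = mform (G x) v v - mform (G x - G y) v v.
  have := mformPm (-1) (G x - G y) (G x) v v.
  by rewrite scaleN1r opprB subrK mulN1r addrC => ->.
rewrite e.
have b' : mform (G x - G y) v v <= mu / 2 * `|v| ^+ 2.
  apply: le_trans (ler_norm _) _; apply: le_trans b _.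
  (* the perturbation changes the form by at most mu / 2 times |v|^2 *)
  have dN : d * N1 = mu / 2 by rewrite divfK ?gt_eqF.
  by rewrite -mulrA -expr2 ler_wpM2r ?exprn_ge0 // -dN mulrC ler_pM2l // /N1 lerDl.
have hv := hmu v; move: hv b'; move: (mform _ _ _) (mform _ _ _) (`|v| ^+ 2) => p q w; lra.
Qed.

Lemma inner_product_mform (b : 'rV[R]_N -> 'rV[R]_N -> R) u v : inner_product b ->
  b u v = mform (\matrix_(i, j) b (basis_vec i) (basis_vec j)) u v.
Proof.
move=> [lin sym _].
have linl w : linear (b^~ w : 'rV[R]_N -> R).
  by move=> a x y; rewrite lin.
have expand w x : b x w = \sum_i x 0 i * b (basis_vec i) w.
  pose LM := GRing.isLinear.Build _ _ _ _ _ (linl w).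
  pose l : {linear 'rV[R]_N -> R} := HB.pack (b^~ w) LM.
  rewrite -[b x w]/(l x) [in LHS](row_sum_delta x) linear_sum.
  by apply: eq_bigr => i _; rewrite linearZ.
rewrite expand mformE exchange_big /=; apply: eq_bigr => i _.
rewrite sym expand mulr_sumr; apply: eq_bigr => j _.
by rewrite mxE sym; ring.
Qed.

Lemma inner_product_posdef (b : 'rV[R]_N -> 'rV[R]_N -> R) : inner_product b ->
  forall v, v != 0 -> 0 < mform (\matrix_(i, j) b (basis_vec i) (basis_vec j)) v v.
Proof. by move=> bi v v0; rewrite -inner_product_mform //; case: bi => _ _; exact. Qed.

Lemma diff_ler (f : 'rV[R]_N -> R) (K : R) z w :
  (forall h, `|'d f z (basis_vec h)| <= K) -> `|'d f z w| <= N%:R * K * `|w|.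
Proof.
move=> hK; rewrite diff_basis; apply: le_trans (ler_norm_sum _ _ _) _.
apply: (@le_trans _ _ (\sum_(i < N) (K * `|w|))).
  apply: ler_sum => i _; rewrite normrM mulrC ler_pM //; exact: coord_ler.
by rewrite sumr_const card_ord -[leLHS]mulr_natl mulrA.
Qed.

End Coercivity.

Section ExteriorDerivative.
Context {R : realType} {N : nat}.
Implicit Types (al be : 'I_N -> 'rV[R]_N -> R) (y X Y : 'rV[R]_N).

(** The exterior derivative at y, evaluated on X and Y, of the 1-form with
    coefficients al. *)
Definition dform al y X Y : R :=
  \sum_i (Y 0 i * 'd (al i) y X - X 0 i * 'd (al i) y Y).

Lemma near_dform al be y X Y : (forall i, \forall z \near y, al i z = be i z) ->
  (forall i, differentiable (al i) y) -> dform al y X Y = dform be y X Y.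
Proof.
move=> ab da; apply: eq_bigr => i _; have e := esym (near_diff (ab i) (da i)).
exact: (congr2 (fun p q => Y 0 i * p - X 0 i * q) (congr1 (fun g => g X) e) (congr1 (fun g => g Y) e)).
Qed.

Lemma dformD al be y X Y :
  (forall i, differentiable (al i) y) -> (forall i, differentiable (be i) y) ->
  dform (fun i z => al i z + be i z) y X Y = dform al y X Y + dform be y X Y.
Proof.
move=> da db; rewrite /dform -big_split; apply: eq_bigr => i _ /=.
have e v : 'd (fun z => al i z + be i z) y v = 'd (al i) y v + 'd (be i) y v.
  exact: (congr1 (fun g => g v) (diffD (da i) (db i))).
apply: etrans (congr2 (fun p q => Y 0 i * p - X 0 i * q) (e X) (e Y)) _.
by rewrite !mulrDr opprD addrACA.
Qed.

Lemma dformZ c al y X Y : (forall i, differentiable (al i) y) ->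
  dform (fun i z => c * al i z) y X Y = c * dform al y X Y.
Proof.
move=> da; rewrite /dform mulr_sumr; apply: eq_bigr => i _.
have e v : 'd (fun z => c * al i z) y v = c * 'd (al i) y v.
  exact: (congr1 (fun g => g v) (diffZ c (da i))).
apply: etrans (congr2 (fun p q => Y 0 i * p - X 0 i * q) (e X) (e Y)) _.
by rewrite mulrBr; congr (_ - _); exact: mulrCA.
Qed.

Lemma dform_sum {p} (al : 'I_p -> 'I_N -> 'rV[R]_N -> R) y X Y :
  (forall l i, differentiable (al l i) y) ->
  dform (fun i z => \sum_l al l i z) y X Y = \sum_l dform (al l) y X Y.
Proof.
move=> da; rewrite /dform exchange_big /=; apply: eq_bigr => i _.
have ev v : 'd (fun z => \sum_l al l i z) y v = \sum_l 'd (al l i) y v.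
  have e : (fun z => \sum_l al l i z) = \sum_l (al l i).
    by apply/funext => z; rewrite fct_sumE.
  rewrite e.
  have D : is_diff y (\sum_l al l i) (\sum_l ('d (al l i) y : 'rV[R]_N -> R)).
    elim/big_rec2: _ => [|l f g _ IH]; first exact: is_diff_cst.
    apply: is_diffD => //; exact: differentiableP.
  by have [_ val] := D; apply: etrans (congr1 (fun g => g v) val) _; rewrite fct_sumE.
apply: etrans (congr2 (fun p q => Y 0 i * p - X 0 i * q) (ev X) (ev Y)) _.
by rewrite !mulr_sumr -sumrB.
Qed.

(** d (df) = 0, by the symmetry of second derivatives. *)
Lemma dform_exact (U : set 'rV[R]_N) (f : 'rV[R]_N -> R) y X Y :
  open U -> U y -> Cr_on 2 U f ->
  dform (fun i => 'D_(basis_vec i) f) y X Y = 0.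
Proof.
move=> oU Uy C2; have [df Df] := C2.
have dDf i : differentiable ('D_(basis_vec i) f) y by exact: (Df i).1.
rewrite /dform sumrB; apply/eqP; rewrite subr_eq0; apply/eqP.
under eq_bigr do rewrite diff_partial // mulr_sumr.
under [RHS]eq_bigr do rewrite diff_partial // mulr_sumr.
rewrite exchange_big /=; apply: eq_bigr => i _; apply: eq_bigr => j _.
by rewrite (Cr_on_swap _ _ oU Uy C2) mulrCA.
Qed.

Fact dform_leibniz_term (Yi Xi c a b f p q : R) :
  Yi * (c * a + f * p) - Xi * (c * b + f * q) =
  c * (Yi * a - Xi * b) + (p * (Yi * f) - q * (Xi * f)).
Proof. by ring. Qed.

(** The 2-form d (u df) is the exterior product of du and df. *)
Lemma dform_mul_exact (U : set 'rV[R]_N) (u f : 'rV[R]_N -> R) y X Y :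
  open U -> U y -> Cr_on 2 U f -> differentiable u y ->
  dform (fun i z => u z * 'D_(basis_vec i) f z) y X Y =
  'd u y X * 'd f y Y - 'd u y Y * 'd f y X.
Proof.
move=> oU Uy C2 du; have [df Df] := C2.
have dDf i : differentiable ('D_(basis_vec i) f) y by exact: (Df i).1.
have e i v : 'd (fun z => u z * 'D_(basis_vec i) f z) y v =
    u y * 'd ('D_(basis_vec i) f) y v + 'D_(basis_vec i) f y * 'd u y v.
  exact: (congr1 (fun g => g v) (diffM du (dDf i))).
transitivity (u y * dform (fun i => 'D_(basis_vec i) f) y X Y
   + ('d u y X * (\sum_i Y 0 i * 'D_(basis_vec i) f y)
   - 'd u y Y * (\sum_i X 0 i * 'D_(basis_vec i) f y))).
  rewrite /dform !mulr_sumr -sumrB -big_split /=; apply: eq_bigr => i _.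
  apply: etrans (congr2 (fun p q => Y 0 i * p - X 0 i * q) (e i X) (e i Y)) _.
  exact: dform_leibniz_term.
by rewrite (dform_exact _ _ oU Uy C2) mulr0 add0r -!diff_partial //; exact: df.
Qed.

End ExteriorDerivative.

(** * The adapted frame of a connection metric *)

Lemma chart_expand {R : realType} {N p} {P : manifold R N}
    (L : 'rV[R]_N -> 'rV[R]_p) (k : chart R P N) (q : P) v :
  linear L -> atlas k -> cdom k q ->
  L v = \sum_i to_chart k q v 0 i *: L (of_chart k q (basis_vec i)).
Proof.
move=> linL ak dk.
pose LM := GRing.isLinear.Build _ _ _ _ _ linL.
pose l : {linear 'rV[R]_N -> 'rV[R]_p} := HB.pack L LM.
pose OM := GRing.isLinear.Build _ _ _ _ _ (@of_chart_lin _ _ _ k q).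
pose o : {linear 'rV[R]_N -> 'rV[R]_N} := HB.pack (of_chart k q) OM.
rewrite -[in LHS](to_chartK v ak dk) -[LHS]/(l (o (to_chart k q v))).
rewrite [in LHS](row_sum_delta (to_chart k q v)) !linear_sum.
by apply: eq_bigr => i _; rewrite !linearZ.
Qed.

Lemma metric_in_chart {R : realType} {N} {P : manifold R N} (g : metric_field P)
    (k : chart R P N) q u v :
  (forall q, inner_product (g q)) -> atlas k -> cdom k q ->
  g q u v = mform (metric_mx g k (cmap k q)) (to_chart k q u) (to_chart k q v).
Proof.
move=> gi ak dk; have [lin sym pos] := gi q.
pose OM := GRing.isLinear.Build _ _ _ _ _ (@of_chart_lin _ _ _ k q).
pose o : {linear 'rV[R]_N -> 'rV[R]_N} := HB.pack (of_chart k q) OM.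
have oinj w : o w = 0 -> w = 0.
  by move=> ow; rewrite -(of_chartK w ak dk) -[of_chart k q w]/(o w) ow /to_chart linear0.
have ib : inner_product (fun a b => g q (o a) (o b)).
  split=> [a x y w|x y|x x0]; first by rewrite linearP lin.
    by rewrite sym.
  by apply: pos; apply: contraNneq x0 => /oinj ->.
rewrite -{1}(to_chartK u ak dk) -{1}(to_chartK v ak dk).
have e : metric_mx g k (cmap k q) = \matrix_(i, j) g q (o (basis_vec i)) (o (basis_vec j)).
  apply/matrixP => i j; rewrite [LHS]mxE [RHS]mxE /metric_coef cmapK //.
rewrite e; exact: (inner_product_mform (to_chart k q u) (to_chart k q v) ib).
Qed.

Section Tube.
Context {R : realType} {n m : nat} {M : manifold R n} {P : manifold R (n + m)}.
Variables (pi : P -> M) (act : P -> 'rV[R]_m -> P) (gM : metric_field M)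
  (omega : P -> 'rV[R]_(n + m) -> 'rV[R]_m) (gG : 'rV[R]_m -> 'rV[R]_m -> R).
Hypotheses (gM_riemannian : riemannian_metric gM)
  (pi_smooth : smooth_map_on setT pi)
  (act_free : free_torus_action act)
  (act_smooth : smooth_action act)
  (omega_conn : connection_form act omega)
  (gG_inner : inner_product gG).
Variables (x0 : M) (U : set M) (s : M -> P).
Hypotheses (oU : open U) (Ux0 : U x0) (triv : trivializing_section pi act U s).

Let kM := chart_at x0.
Let z0 := cmap kM x0.
Let akM : atlas kM := chart_at_atlas x0.
Let dkM : cdom kM x0 := chart_at_dom x0.

Definition base_coord (q : P) : 'rV[R]_n := cmap kM (pi q).

(** The components of the form A = s^* omega on the base. *)
Definition gauge_potential (l : 'I_n) (a : 'I_m) (z : 'rV[R]_n) : R :=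
  omega (s (cinv kM z)) (tangent_map s (cinv kM z) (of_chart kM (cinv kM z) (basis_vec l))) 0 a.

Definition base_metric (z : 'rV[R]_n) : 'M[R]_(n + m) :=
  block_mx (metric_mx gM kM z) 0 0 (\matrix_(i, j) gG (basis_vec i) (basis_vec j)).

(** The coframe (dx, eps omega). The factor eps absorbs the parameter of the
    connection metric, whose coefficients become [base_metric]. *)
Definition kk_frame (eps : R) (q : P) (v : 'rV[R]_(n + m)) : 'rV[R]_(n + m) :=
  row_mx (to_chart kM (pi q) (tangent_map pi q v)) (eps *: omega q v).

(** Near z0 all the points of the section lie in the single chart kp, in which
    A is a combination of the smooth coefficients of omega with the partial
    derivatives of s. *)
Lemma gauge_potential_C1_at l a : C1_at (gauge_potential l a) z0.
Proof.
have [s_smooth _ _] := triv.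
have [omlin omsm _ _] := omega_conn.
pose kp := chart_at (s x0).
have akp : atlas kp := chart_at_atlas (s x0).
have dkp : cdom kp (s x0) := chart_at_dom (s x0).
pose Fs z := cmap kp (s (cinv kM z)).
pose V : set 'rV[R]_n := cmap kM @` (cdom kM `&` U `&` s @^-1` cdom kp).
have nV : \forall z \near z0, [/\ cimg kM z, U (cinv kM z) & cdom kp (s (cinv kM z))].
  have nU : nbhs x0 U by exact: open_nbhs_nbhs.
  have ns : \forall x \near x0, cdom kp (s x) by exact: (s_smooth.1 _ Ux0 _ (near_cdom dkp)).
  apply: filterS3 (near_cimg dkM) (near_cinv dkM nU) (near_cinv dkM ns) => z; exact: And3.
have VE z : [/\ cimg kM z, U (cinv kM z) & cdom kp (s (cinv kM z))] -> V z.
  move=> [kz Uz dz]; exists (cinv kM z); last exact: cinvK.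
  by split=> //; split=> //; exact: cimg_cdom.
have C2F r j : Cr_on r V (fun z => Fs z 0 j) by exact: (s_smooth.2 _ _ akM akp r j).
have oV : open V.
  rewrite openE => z [x [[dx Ux] dsx] <-].
  have nU : nbhs x U by exact: open_nbhs_nbhs.
  have ns : \forall x' \near x, cdom kp (s x') by exact: (s_smooth.1 _ Ux _ (near_cdom dsx)).
  by apply: filterS3 (near_cimg dx) (near_cinv dx nU) (near_cinv dx ns) => z' ? ? ?; apply: VE.
have Vz0 : V z0 by exact: VE (nbhs_singleton nV).
pose om j y := omega (cinv kp y) (of_chart kp (cinv kp y) (basis_vec j)) 0 a.
have E : \forall z \near z0, \sum_j 'D_(basis_vec l) (fun z => Fs z 0 j) z * om j (Fs z)
    = gauge_potential l a z.
  apply: filterS nV => z [kz Uz dz].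
  rewrite /gauge_potential.
  have linom : linear (omega (s (cinv kM z))) by move=> c u v; exact: omlin.
  rewrite (chart_expand _ linom akp dz) summxE; apply: eq_bigr => j _.
  rewrite mxE /om /Fs cmapK //; congr (_ * _).
  rewrite (to_chart_tangent_map _ s_smooth Uz akM akp (cimg_cdom kz) dz).
  rewrite of_chartK //; last exact: cimg_cdom.
  rewrite cinvK // deriveE; last by have [+ _] := C2F 1 j; apply; apply: VE.
  rewrite -[RHS]diff_coord //.
  apply: differentiable_row => j'; have [+ _] := C2F 1 j'; apply; exact: VE.
apply: near_C1_at E _; apply: C1_at_sum => j; apply: C1_at_M.
  have [_ Df] := C2F 2 j; exact: Cr_on_C1_at oV Vz0 (Df l).
apply: (C1_at_comp (f := om j) (g := Fs)).
  by move=> i; exact: Cr_on_C1_at oV Vz0 (C2F 1 i).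
have e : cmap kp (s x0) = Fs z0 by rewrite /Fs /z0 cmapK.
have h : Cr_on 1 (cimg kp) (om j) by exact: (omsm kp akp j 1 a).
have okp : open (cimg kp) by exact: cimg_open.
by rewrite -e; exact: Cr_on_C1_at okp (cimg_cmap dkp) h.
Qed.

Definition base_dom (k : chart R P (n + m)) : set 'rV[R]_(n + m) :=
  cmap k @` (cdom k `&` setT `&` pi @^-1` cdom kM).

Definition coord_in (k : chart R P (n + m)) (l : 'I_n) (y : 'rV[R]_(n + m)) : R :=
  base_coord (cinv k y) 0 l.

Lemma near_pi (q : P) (A : set M) : nbhs (pi q) A -> \forall q' \near q, A (pi q').
Proof. by move=> nA; exact: (pi_smooth.1 q I _ nA). Qed.

Lemma open_base_dom k : open (base_dom k).
Proof.
rewrite /base_dom -setIA; apply: open_chart_image; rewrite setTI.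
rewrite openE => q dq; exact: near_pi (near_cdom dq).
Qed.

Lemma base_dom_cmap k q : cdom k q -> cdom kM (pi q) -> base_dom k (cmap k q).
Proof. by move=> dk dq; exists q. Qed.

Lemma base_domP k y : base_dom k y -> cimg k y /\ cdom kM (pi (cinv k y)).
Proof. by move=> [q [[dk _] dq] <-]; split; [exact: cimg_cmap|rewrite cmapK]. Qed.

Lemma near_base_dom k q : cdom k q -> cdom kM (pi q) ->
  \forall y \near cmap k q, base_dom k y.
Proof.
by move=> dk dq; apply: open_nbhs_nbhs; split; [exact: open_base_dom|exact: base_dom_cmap].
Qed.

Lemma coord_in_Cr k r l : atlas k -> Cr_on r (base_dom k) (coord_in k l).
Proof. by move=> ak; exact: (pi_smooth.2 k kM ak akM r l). Qed.

Lemma coord_in_differentiable k l y : atlas k -> base_dom k y ->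
  differentiable (coord_in k l) y.
Proof. by move=> ak ky; have [+ _] := coord_in_Cr 1 l ak; exact. Qed.

Lemma base_coord_differentiable k y : atlas k -> base_dom k y ->
  differentiable (base_coord \o cinv k) y.
Proof. by move=> ak ky; apply: differentiable_row => l; exact: coord_in_differentiable. Qed.

Lemma d_base_coord k q v : atlas k -> cdom k q -> cdom kM (pi q) ->
  to_chart kM (pi q) (tangent_map pi q v) =
  'd (base_coord \o cinv k) (cmap k q) (to_chart k q v).
Proof. by move=> ak dk dq; exact: (to_chart_tangent_map _ pi_smooth I ak akM dk dq). Qed.

Lemma d_coord_in k q v l : atlas k -> cdom k q -> cdom kM (pi q) ->
  'd (coord_in k l) (cmap k q) (to_chart k q v) =
  to_chart kM (pi q) (tangent_map pi q v) 0 l.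
Proof.
move=> ak dk dq; rewrite (d_base_coord _ ak dk dq) -diff_coord //.
by apply: base_coord_differentiable => //; exact: base_dom_cmap.
Qed.

Definition omega_coef (k : chart R P (n + m)) (i : 'I_(n + m)) (a : 'I_m) (y : 'rV[R]_(n + m)) : R :=
  omega (cinv k y) (of_chart k (cinv k y) (basis_vec i)) 0 a.

Lemma kk_frame_mxl eps k y i l : atlas k -> base_dom k y ->
  frame_mx (kk_frame eps) k y i (lshift m l) = 'D_(basis_vec i) (coord_in k l) y.
Proof.
move=> ak ky; have [cy dy] := base_domP ky; have dk := cimg_cdom cy.
rewrite mxE /kk_frame row_mxEl -(d_coord_in _ _ ak dk dy) of_chartK // cinvK //.
by rewrite deriveE //; exact: coord_in_differentiable.
Qed.

Lemma kk_frame_mxr eps k y i a :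
  frame_mx (kk_frame eps) k y i (rshift n a) = eps * omega_coef k i a y.
Proof. by rewrite mxE /kk_frame row_mxEr mxE. Qed.

Lemma omega_coef_C1_at k q i a : atlas k -> cdom k q -> C1_at (omega_coef k i a) (cmap k q).
Proof.
move=> ak dk; have [_ omsm _ _] := omega_conn.
have h : Cr_on 1 (cimg k) (omega_coef k i a) by exact: (omsm k ak i 1 a).
have ok : open (cimg k) by exact: cimg_open.
exact: Cr_on_C1_at ok (cimg_cmap dk) h.
Qed.

Lemma kk_frame_C1_at eps k q i j : atlas k -> cdom k q -> cdom kM (pi q) ->
  C1_at (fun y => frame_mx (kk_frame eps) k y i j) (cmap k q).
Proof.
move=> ak dk dq; rewrite -(splitK j); case: (fintype.split j) => [l|a] /=.
  have h : \forall y \near cmap k q, 'D_(basis_vec i) (coord_in k l) y =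
      frame_mx (kk_frame eps) k y i (lshift m l).
    by apply: filterS (near_base_dom dk dq) => y ky; rewrite kk_frame_mxl.
  apply: near_C1_at h _.
  have [_ Df] := coord_in_Cr 2 l ak.
  have h1 : Cr_on 1 (base_dom k) ('D_(basis_vec i) (coord_in k l)) by exact: (Df i).
  have h2 := base_dom_cmap dk dq.
  have h3 := @open_base_dom k.
  exact: Cr_on_C1_at h3 h2 h1.
have -> : (fun y => frame_mx (kk_frame eps) k y i (rshift n a)) = (fun y => eps * omega_coef k i a y).
  by apply/funext => y; rewrite kk_frame_mxr.
by apply: C1_at_Z; exact: omega_coef_C1_at.
Qed.

(** The identity omega = dtau + A(x) dx in a chart of P. The function tau, a
    local logarithm of the torus coordinate, depends on the point q, but A
    does not. *)
Lemma omega_coefE k q : atlas k -> cdom k q -> cdom kM (pi q) -> U (pi q) ->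
  exists (O : set 'rV[R]_(n + m)) (tau : P -> 'rV[R]_m),
   [/\ open O, O (cmap k q), (forall a r, Cr_on r O (fun y => tau (cinv k y) 0 a)) &
    forall i a, \forall y \near cmap k q,
      omega_coef k i a y = 'D_(basis_vec i) (fun y => tau (cinv k y) 0 a) y
       + \sum_l gauge_potential l a (base_coord (cinv k y)) * 'D_(basis_vec i) (coord_in k l) y].
Proof.
move=> ak dk dq Uq; have [s_smooth _ loc] := triv.
have [W [tau [oW Wq WU tau_smooth tauE]]] := loc q Uq.
have [omlin _ _ _] := omega_conn.
exists (cmap k @` (cdom k `&` W)), tau.
have tauC a r : Cr_on r (cmap k @` (cdom k `&` W)) (fun y => tau (cinv k y) 0 a).
  exact: (tau_smooth k ak r a).
split=> //; first exact: open_chart_image.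
  by exists q.
move=> i a.
have nW : nbhs q W by exact: open_nbhs_nbhs.
apply: filterS2 (near_base_dom dk dq) (near_cinv dk nW) => y ky Wy.
have [cy dy] := base_domP ky; have dky := cimg_cdom cy.
set q' := cinv k y in Wy dy dky *.
set v := of_chart k q' (basis_vec i).
have Uq' : U (pi q') := WU _ Wy.
rewrite /omega_coef -/q' -/v.
rewrite (connection_decomposition pi_smooth act_free act_smooth s_smooth oW WU tau_smooth tauE omega_conn v Wy).
rewrite mxE addrC; congr (_ + _).
  have [akq dkq] := (chart_at_atlas q', chart_at_dom q').
  have dt : differentiable (tau \o cinv (chart_at q')) (cmap (chart_at q') q').
    exact: (smooth_vec_diff tau_smooth).
  rewrite (diff_of_chart _ ak dky dt) cinvK // deriveE.
    by rewrite -diff_coord //; rewrite -(cinvK cy); exact: (smooth_vec_diff tau_smooth).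
  by have [+ _] := tauC a 1; apply; exists q' => //; exact: cinvK.
have linL : linear (fun w => omega (s (pi q')) (tangent_map s (pi q') w)).
  by move=> c u w; rewrite /tangent_map linearP omlin.
rewrite (chart_expand _ linL akM dy) summxE; apply: eq_bigr => l _.
rewrite mxE -(d_coord_in v l ak dky dy) mulrC /v of_chartK // cinvK //.
rewrite deriveE; last exact: coord_in_differentiable.
by rewrite /gauge_potential /base_coord cmapK.
Qed.

Section Structure.
Variables (q : P) (eps K E : R).
Hypotheses (dq : cdom kM (pi q)) (Uq : U (pi q)) (eps0 : 0 <= eps) (epsE : eps <= E) (K0 : 0 <= K).
Hypothesis gauge_diff : forall l a, differentiable (gauge_potential l a) (base_coord q).
Hypothesis gauge_bound : forall l a h,
  `|'d (gauge_potential l a) (base_coord q) (basis_vec h)| <= K.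

Let k := chart_at q.
Let ak : atlas k := chart_at_atlas q.
Let dk : cdom k q := chart_at_dom q.
Let y0 := cmap k q.
Let Th := frame_mx (kk_frame eps) k.

Lemma dform_frame X Y j :
  (Y *m dmx Th y0 X - X *m dmx Th y0 Y) 0 j = dform (fun i y => Th y i j) y0 X Y.
Proof.
rewrite mxE [X in X + _ = _]mxE [X in _ + X = _]mxE [X in _ - X = _]mxE -sumrB.
by apply: eq_bigr => i _; rewrite [dmx _ _ X i j]mxE [dmx _ _ Y i j]mxE.
Qed.

Lemma dform_framel X Y l : dform (fun i y => Th y i (lshift m l)) y0 X Y = 0.
Proof.
have h i : \forall y \near y0, Th y i (lshift m l) = 'D_(basis_vec i) (coord_in k l) y.
  by apply: filterS (near_base_dom dk dq) => y ky; exact: kk_frame_mxl.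
rewrite (near_dform _ _ h); last first.
  by move=> i; apply: C1_at_differentiable; exact: kk_frame_C1_at.
exact: dform_exact (@open_base_dom k) (base_dom_cmap dk dq) (coord_in_Cr 2 l ak).
Qed.

Let dz (X : 'rV[R]_(n + m)) : 'rV[R]_n := to_chart kM (pi q) (tangent_map pi q X).

Lemma dz_coord X l : 'd (coord_in k l) y0 X = dz X 0 l.
Proof. by rewrite -[X in LHS](@to_chart_at _ _ _ q); exact: d_coord_in. Qed.

Lemma dz_base X : 'd (base_coord \o cinv k) y0 X = dz X.
Proof. by rewrite -[X in LHS](@to_chart_at _ _ _ q) -d_base_coord. Qed.

Lemma is_diff_base_fun (f : 'rV[R]_n -> R) : differentiable f (base_coord q) ->
  is_diff y0 (fun y => f (base_coord (cinv k y))) (fun X => 'd f (base_coord q) (dz X)).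
Proof.
move=> df.
have d1 := differentiableP (base_coord_differentiable ak (base_dom_cmap dk dq)).
have d2 : is_diff ((base_coord \o cinv k) y0) f ('d f (base_coord q)).
  by rewrite /= cmapK //; exact: differentiableP.
have [ex val] := is_diff_comp d1 d2.
split; first exact: ex.
by apply: etrans val _; apply/funext => X; rewrite /= dz_base.
Qed.

(** d omega = dA: the curvature of an abelian connection is a 2-form on the
    base. *)
Lemma dform_framer X Y a : dform (fun i y => Th y i (rshift n a)) y0 X Y =
  eps * \sum_l ('d (gauge_potential l a) (base_coord q) (dz X) * dz Y 0 l
    - 'd (gauge_potential l a) (base_coord q) (dz Y) * dz X 0 l).
Proof.
have [B [tau [oO Oq tauC tauE]]] := omega_coefE ak dk dq Uq.
have h1 i : \forall y \near y0, Th y i (rshift n a) = eps * omega_coef k i a y.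
  by apply: filterS (near_base_dom dk dq) => y _; exact: kk_frame_mxr.
rewrite (near_dform _ _ h1); last first.
  by move=> i; apply: C1_at_differentiable; exact: kk_frame_C1_at.
have dom i : differentiable (omega_coef k i a) y0.
  by apply: C1_at_differentiable; exact: omega_coef_C1_at.
rewrite (dformZ _ _ _ dom); congr (_ * _).
rewrite (near_dform _ _ (fun i => tauE i a) dom).
have dtau i : differentiable ('D_(basis_vec i) (fun y => tau (cinv k y) 0 a)) y0.
  by have [_ Df] := tauC a 2; exact: (Df i).1.
have dco l i : differentiable ('D_(basis_vec i) (coord_in k l)) y0.
  by have [_ Df] := coord_in_Cr 2 l ak; exact: ((Df i).1 _ (base_dom_cmap dk dq)).
have dga l : is_diff y0 (fun y => gauge_potential l a (base_coord (cinv k y)))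
    (fun X => 'd (gauge_potential l a) (base_coord q) (dz X)).
  exact: is_diff_base_fun.
have dpr l i : differentiable (fun y => gauge_potential l a (base_coord (cinv k y)) * 'D_(basis_vec i) (coord_in k l) y) y0.
  by apply: differentiableM; [exact: ex_diff|exact: dco].
rewrite dformD //; last first.
  move=> i.
  have e : (fun y => \sum_l gauge_potential l a (base_coord (cinv k y)) * 'D_(basis_vec i) (coord_in k l) y)
    = \sum_l (fun y => gauge_potential l a (base_coord (cinv k y)) * 'D_(basis_vec i) (coord_in k l) y).
    by apply/funext => y; rewrite fct_sumE.
  by rewrite e; apply: differentiable_sum => l; exact: dpr.
rewrite (dform_exact _ _ oO Oq (tauC a 2)) add0r dform_sum //.
apply: eq_bigr => l _.
have [dg vg] := dga l.
rewrite (dform_mul_exact _ _ (@open_base_dom k) (base_dom_cmap dk dq) (coord_in_Cr 2 l ak) dg).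
exact: (congr2 (fun u v => u - v)
  (congr2 (fun u v => u * v) (congr1 (fun g => g X) vg) (dz_coord Y l))
  (congr2 (fun u v => u * v) (congr1 (fun g => g Y) vg) (dz_coord X l))).
Qed.

(** The curvature only enters multiplied by eps, so the bound is uniform for
    eps <= E. *)
Lemma kk_frame_struct X Y :
  `|Y *m dmx Th y0 X - X *m dmx Th y0 Y| <=
   E * (2 * n%:R * (n%:R * K)) * `|kk_frame eps q X| * `|kk_frame eps q Y|.
Proof.
have zX : `|dz X| <= `|kk_frame eps q X| by exact: (row_mx_norm_ge _ _).1.
have zY : `|dz Y| <= `|kk_frame eps q Y| by exact: (row_mx_norm_ge _ _).1.
have E0 : 0 <= E := le_trans eps0 epsE.
have nK0 : 0 <= n%:R * K by rewrite mulr_ge0.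
set V := `|kk_frame eps q X| in zX *; set W := `|kk_frame eps q Y| in zY *.
have V0 : 0 <= V by exact: normr_ge0.
have W0 : 0 <= W by exact: normr_ge0.
have rhs0 : 0 <= E * (2 * n%:R * (n%:R * K)) * V * W by rewrite !mulr_ge0.
apply: row_norm_le => // j; rewrite dform_frame -(splitK j); case: (fintype.split j) => [l|a] /=.
  by rewrite dform_framel normr0.
rewrite dform_framer normrM (ger0_norm eps0) -!mulrA; apply: ler_pM => //.
apply: le_trans (ler_norm_sum _ _ _) _.
apply: (@le_trans _ _ (\sum_(l < n) (2 * (n%:R * K * V * W)))).
  apply: ler_sum => l _; apply: le_trans (ler_normB _ _) _.
  rewrite mulr_natl mulr2n; apply: lerD; rewrite normrM.
    apply: ler_pM => //; last exact: le_trans (coord_ler _ _) zY.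
    apply: le_trans (diff_ler _ (gauge_bound l a)) _.
    by rewrite ler_wpM2l.
  rewrite -[leRHS]mulrA [V * W]mulrC mulrA; apply: ler_pM => //; last exact: le_trans (coord_ler _ _) zX.
  apply: le_trans (diff_ler _ (gauge_bound l a)) _.
  by rewrite ler_wpM2l.
rewrite sumr_const card_ord -[leLHS]mulr_natl.
by rewrite le_eqVlt; apply/orP; left; apply/eqP; ring.
Qed.

End Structure.

Definition tube (r : R) : set P :=
  [set q | cdom kM (pi q) /\ `|z0 - base_coord q| < r].

Lemma open_tube r : open (tube r).
Proof.
rewrite openE => q [dq bq].
have nb : nbhs (base_coord q) [set z | `|z0 - z| < r].
  have e : ball z0 r = [set z | `|z0 - z| < r] by rewrite -ball_normE.
  by rewrite -e; apply: open_nbhs_nbhs; split; [exact: ball_open|rewrite e].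
have nb' : \forall x \near pi q, `|z0 - cmap kM x| < r by exact: (cmap_continuous dq nb).
apply: filterS2 (near_pi (near_cdom dq)) (near_pi nb') => q' d b; exact: conj.
Qed.

Lemma kk_frame_linear eps q : linear (kk_frame eps q).
Proof.
move=> a u v; have [omlin _ _ _] := omega_conn.
by rewrite /kk_frame /tangent_map linearP to_chart_lin omlin scalerDr scale_row_mx
  add_row_mx scalerA mulrC -scalerA.
Qed.

(** This is what makes the connection metric definite. *)
Lemma kk_frame_inj eps q v : 0 < eps -> cdom kM (pi q) -> U (pi q) ->
  kk_frame eps q v = 0 -> v = 0.
Proof.
move=> eps0 dq Uq kv0; have : kk_frame eps q v = row_mx 0 0 by rewrite row_mx0.
move=> /eq_row_mx [tv ov].
have [s_smooth _ loc] := triv.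
have [W [tau [oW Wq WU tau_smooth tauE]]] := loc q Uq.
have t0 : tangent_map pi q v = 0.
  by rewrite -(to_chartK (tangent_map pi q v) akM dq) tv /of_chart linear0.
have o0 : omega q v = 0.
  by apply: (scalerI (a := eps)); [rewrite gt_eqF|rewrite ov scaler0].
exact: (connection_injective pi_smooth act_free act_smooth s_smooth oW WU tau_smooth tauE omega_conn Wq t0 o0).
Qed.

Lemma kk_frame_metric eps q u v : cdom kM (pi q) ->
  connection_metric pi gM omega gG eps q u v =
  mform (base_metric (base_coord q)) (kk_frame eps q u) (kk_frame eps q v).
Proof.
move=> dq; rewrite /connection_metric /base_metric /kk_frame mform_block.
congr (_ + _); first exact: metric_in_chart gM_riemannian.1 akM dq.
rewrite mformZl -[eps *: omega q v]addr0 mformPr {2}/mform trmx0 mulmx0 mxE addr0.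
by rewrite (inner_product_mform _ _ gG_inner) mulrA expr2.
Qed.

Lemma base_metric_sym z : (base_metric z)^T = base_metric z.
Proof.
rewrite /base_metric tr_block_mx !trmx0; congr block_mx.
  apply/matrixP => i j; rewrite [LHS]mxE [LHS]mxE [RHS]mxE /metric_coef.
  by have [_ sym _] := gM_riemannian.1 (cinv kM z); exact: sym.
apply/matrixP => i j; rewrite [LHS]mxE [LHS]mxE [RHS]mxE.
by have [_ sym _] := gG_inner; exact: sym.
Qed.

Lemma base_metric_posdef v : v != 0 -> 0 < mform (base_metric z0) v v.
Proof.
have pM : forall a, a != 0 -> 0 < mform (metric_mx gM kM z0) a a.
  have -> : metric_mx gM kM z0 = \matrix_(i, j) gM x0 (basis_vec i) (basis_vec j).
    by apply/matrixP => i j; rewrite [LHS]mxE [RHS]mxE /metric_coef cmapK // !of_chart_at.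
  exact: inner_product_posdef (gM_riemannian.1 x0).
have pG := inner_product_posdef gG_inner.
have m0 p (A : 'M[R]_p) : mform A 0 0 = 0 by rewrite /mform !mul0mx mxE.
rewrite -(hsubmxK v); move: (lsubmx v) (rsubmx v) => a b nz.
rewrite /base_metric mform_block.
have [a0|a0] := eqVneq a 0; last first.
  have [b0|b0] := eqVneq b 0; first by rewrite b0 m0 addr0 pM.
  by rewrite addr_gt0 ?pM ?pG.
rewrite a0 m0 add0r; apply: pG; apply: contraNneq nz => b0.
by rewrite a0 b0 row_mx0.
Qed.

Lemma base_metric_C1_at i j : C1_at (fun z => base_metric z i j) z0.
Proof.
rewrite -(splitK i) -(splitK j).
case: (fintype.split i) (fintype.split j) => [i'|i'] [j'|j'] /=.
- have -> : (fun z => base_metric z (lshift m i') (lshift m j')) = metric_coef gM kM i' j'.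
    by apply/funext => z; rewrite block_mxEul mxE.
  have okM : open (cimg kM) by exact: cimg_open.
  exact: Cr_on_C1_at okM (cimg_cmap dkM) (gM_riemannian.2 kM akM 1 i' j').
- have -> : (fun z => base_metric z (lshift m i') (rshift n j')) = fun=> 0.
    by apply/funext => z; rewrite block_mxEur mxE.
  exact: C1_at_cst.
- have -> : (fun z => base_metric z (rshift n i') (lshift m j')) = fun=> 0.
    by apply/funext => z; rewrite block_mxEdl mxE.
  exact: C1_at_cst.
have -> : (fun z => base_metric z (rshift n i') (rshift n j')) = fun=> gG (basis_vec i') (basis_vec j').
  by apply/funext => z; rewrite block_mxEdr mxE.
exact: C1_at_cst.
Qed.

(** All the quantities to be bounded are functions of the base coordinates
    that are continuous at z0 and do not involve eps, except for the factor
    eps in the exterior derivative of the frame; so the bounds at z0 extend to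
    a small ball, uniformly in eps <= E. *)
Lemma kk_adapted_frame E : 0 <= E -> exists r K lam,
  [/\ 0 < r, (forall z, `|z0 - z| < r -> cimg kM z) &
    forall eps, 0 < eps -> eps <= E ->
    adapted_frame (connection_metric pi gM omega gG eps) (tube r) (kk_frame eps)
      (fun q => base_metric (base_coord q)) K lam].
Proof.
move=> E0.
have [lam lam0 hlam] := posdef_coercive_near
  (fun i j => C1_at_continuous (base_metric_C1_at i j)) base_metric_posdef.
have [K1 K10 hK1] := near_bounded_fin
  (fun ij : 'I_(n + m) * 'I_(n + m) => C1_at_continuous (base_metric_C1_at ij.1 ij.2)).
have [K2 K20 hK2] := near_bounded_fin
  (fun ijh : ('I_(n + m) * 'I_(n + m)) * 'I_n =>
     (base_metric_C1_at ijh.1.1 ijh.1.2).2 (basis_vec ijh.2)).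
have [K3 K30 hK3] := near_bounded_fin
  (fun lah : ('I_n * 'I_m) * 'I_n =>
     (gauge_potential_C1_at lah.1.1 lah.1.2).2 (basis_vec lah.2)).
have dB := @filter_forall _ _ (fun (ij : 'I_(n + m) * 'I_(n + m)) z =>
  differentiable (fun z => base_metric z ij.1 ij.2) z) (nbhs z0) _
  (fun ij => (base_metric_C1_at ij.1 ij.2).1).
have dA := @filter_forall _ _ (fun (la : 'I_n * 'I_m) z =>
  differentiable (gauge_potential la.1 la.2) z) (nbhs z0) _
  (fun la => (gauge_potential_C1_at la.1 la.2).1).
have nU : nbhs x0 U by exact: open_nbhs_nbhs.
have nz : nbhs z0 (fun z => [/\ cimg kM z, U (cinv kM z),
   (forall v, lam * `|v| ^+ 2 <= mform (base_metric z) v v) &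
   (forall ij : 'I_(n + m) * 'I_(n + m), `|base_metric z ij.1 ij.2| <= K1)]).
  by apply: filterS2 (filterI (near_cimg dkM) (near_cinv dkM nU)) (filterI hlam hK1) => z [? ?] [? ?].
have FI (A B : set 'rV[R]_n) : nbhs z0 A -> nbhs z0 B -> nbhs z0 (A `&` B).
  exact: filterI.
have Fz : Filter (nbhs z0) by exact: nbhs_filter.
have nz' := FI _ _ (FI _ _ hK2 hK3) (FI _ _ (dB Fz) (dA Fz)).
have [r /= r0 hr] := (nbhs_ballP _ _).1 (FI _ _ nz nz').
have eb : ball z0 r = [set z | `|z0 - z| < r] by rewrite -ball_normE.
rewrite eb in hr.
have Uq q : tube r q -> U (pi q).
  by move=> [dq /hr [[_ + _ _] _]]; rewrite /base_coord cmapK.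
exists r, (K1 + n%:R * K2 + E * (2 * n%:R * (n%:R * K3))), lam; split=> //.
  by move=> z /hr [[]].
have nK2 : 0 <= n%:R * K2 by rewrite mulr_ge0.
have nK3 : 0 <= E * (2 * n%:R * (n%:R * K3)) by rewrite !mulr_ge0.
move=> eps eps0 epsE; split=> //.
- exact: open_tube.
- exact: kk_frame_linear.
- by move=> q v Oq; apply: kk_frame_inj => //; [exact: Oq.1|exact: Uq].
- by move=> q u v Oq; apply: kk_frame_metric; exact: Oq.1.
- by move=> q _; exact: base_metric_sym.
- by move=> q v [_ /hr [[_ _ + _] _]]; exact.
- by rewrite !addr_ge0.
- move=> q i j [_ /hr [[_ _ _ h] _]].
  by apply: le_trans (h (i, j)) _; rewrite -addrA lerDl addr_ge0.
- by move=> k q i j ak dk [dq _]; exact: kk_frame_C1_at.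
- move=> q [dq /hr [_ [_ [dBz _]]]] i j.
  by have [] := is_diff_base_fun dq (dBz (i, j)).
- move=> q X i j [dq /hr [_ [[h2 _] [dBz _]]]].
  have [_ e] := is_diff_base_fun dq (dBz (i, j)).
  rewrite mxE.
  have -> : 'd (fun y => ((fun q' => base_metric (base_coord q')) \o cinv (chart_at q)) y i j)
     (cmap (chart_at q) q) X =
     'd (fun z => base_metric z i j) (base_coord q) (to_chart kM (pi q) (tangent_map pi q X)).
    exact: (congr1 (fun g => g X) e).
  have h2' h : `|'d (fun z => base_metric z i j) (base_coord q) (basis_vec h)| <= K2.
    exact: (h2 (i, j, h)).
  apply: le_trans (diff_ler _ h2') _.
  apply: ler_pM => //; last exact: (row_mx_norm_ge _ _).1.
  by rewrite addrAC lerDr addr_ge0.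
move=> q X Y Oq; have [dq /hr [_ [[_ h3] [_ dAz]]]] := Oq.
apply: le_trans (kk_frame_struct dq (Uq q Oq) (ltW eps0) epsE K30 _ _ X Y) _.
- by move=> l a; exact: (dAz (l, a)).
- by move=> l a h; exact: (h3 (l, a, h)).
by rewrite ler_wpM2r // ler_wpM2r // lerDr addr_ge0.
Qed.

(** The closed ball of radius r / 2 is carried by the chart to a compact,
    hence closed, subset of M. A point q outside the tube projects outside
    this set, and so do its neighbors; those which belong to the tube have
    their base coordinates outside the ball. *)
Lemma tube_exit r q : 0 < r -> (forall z, `|z0 - z| < r -> cimg kM z) ->
  ~ tube r q -> \forall q' \near q, tube r q' ->
  1 <= (2 / r) ^+ 2 * \sum_i (base_coord q' 0 i - z0 0 i) ^+ 2.
Proof.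
move=> r0 hr nq.
pose D := [set z : 'rV[R]_n | `|z0 - z| <= r / 2].
have r2 : r / 2 < r by rewrite ltr_pdivrMr // ltr_pMr // ltr1n.
have cD : compact D.
  apply: bounded_closed_compact.
    exists (`|z0| + r / 2); split; first exact: num_real.
    move=> B hB z /= zD; apply: ltW; apply: le_lt_trans hB.
    by rewrite -(subKr z0 z) (le_trans (ler_normB _ _)) // lerD2l.
  have -> : D = (fun z : 'rV[R]_n => `|z0 - z|) @^-1` [set x | x <= r / 2] by [].
  apply: closed_comp => [v _|]; last exact: closed_le.
  apply: continuous_comp; last exact: norm_continuous.
  by apply: continuousB; [exact: cst_continuous|exact: cvg_id].
have cC : closed (cinv kM @` D).
  apply: compact_closed; first exact: manifold_hausdorff.
  apply: continuous_compact => //; apply: continuous_in_subspaceT => z; rewrite inE => Dz.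
  by apply: cinv_continuous; apply: hr; exact: le_lt_trans Dz r2.
have nC : ~ (cinv kM @` D) (pi q).
  move=> [z Dz zE]; apply: nq.
  have cz : cimg kM z by apply: hr; exact: le_lt_trans Dz r2.
  split; first by rewrite -zE; exact: cimg_cdom.
  by rewrite /base_coord -zE cinvK //; exact: le_lt_trans Dz r2.
have nn : nbhs (pi q) (~` (cinv kM @` D)).
  by apply: open_nbhs_nbhs; split=> //; exact: closed_openC.
apply: filterS (near_pi nn) => q' nC' [dq' _].
have far : r / 2 < `|z0 - base_coord q'|.
  rewrite ltNge; apply/negP => h; apply: nC'; exists (base_coord q') => //.
  by rewrite /base_coord cmapK.
have r20 : 0 < r / 2 by rewrite divr_gt0.
have [i hi] : exists i, r / 2 < `|(z0 - base_coord q') 0 i|.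
  apply: contrapT => h; move: far; rewrite ltNge => /negP; apply.
  apply: row_norm_le; first exact: ltW.
  by move=> i; rewrite leNgt; apply/negP => hi; apply: h; exists i.
have h1 : (r / 2) ^+ 2 <= \sum_i (base_coord q' 0 i - z0 0 i) ^+ 2.
  apply: (@le_trans _ _ ((base_coord q' 0 i - z0 0 i) ^+ 2)).
    rewrite -[leRHS]real_normK ?num_real // distrC lerXn2r ?nnegrE ?(ltW r20) //.
    by move: hi; rewrite !mxE; exact: ltW.
  by rewrite (bigD1 i) //= lerDl; apply: sumr_ge0 => j _; exact: sqr_ge0.
have e : (2 / r) ^+ 2 * (r / 2) ^+ 2 = 1 by rewrite -exprMn; field; rewrite gt_eqF.
by rewrite -[leLHS]e; apply: ler_wpM2l => //; exact: sqr_ge0.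
Qed.

Lemma base_coord_curve c t i : smooth_curve c -> cdom kM (pi (c t)) ->
  C1_at (fun s => base_coord (c s) 0 i) t /\
  'd (fun s => base_coord (c s) 0 i) t (1:R) =
  to_chart kM (pi (c t)) (tangent_map pi (c t) (velocity c t)) 0 i.
Proof.
move=> sc dq; set k := chart_at (c t).
have ak : atlas k := chart_at_atlas (c t); have dk : cdom k (c t) := chart_at_dom (c t).
have h : \forall s \near t, coord_in k i (cmap k (c s)) = base_coord (c s) 0 i.
  by apply: filterS (near_curve sc (near_cdom dk)) => s' ds; rewrite /coord_in cmapK.
have C : C1_at (fun s => coord_in k i (cmap k (c s))) t.
  apply: (C1_at_comp (f := coord_in k i) (g := fun s => cmap k (c s))).
    by move=> j; exact: curve_C1_at.
  exact: Cr_on_C1_at (@open_base_dom k) (base_dom_cmap dk dq) (coord_in_Cr 1 i ak).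
split; first exact: near_C1_at h C.
have e := near_diff h (C1_at_differentiable C).
apply: etrans (congr1 (fun g => g (1:R)) e) _.
have d1 := differentiableP (curve_diff sc ak dk).
have d2 := differentiableP (coord_in_differentiable i ak (base_dom_cmap dk dq)).
have [_ val] := is_diff_comp d1 d2.
apply: etrans (congr1 (fun g => g (1:R)) val) _.
rewrite -(d_coord_in _ _ ak dk dq); congr ('d _ _ _).
by rewrite to_chart_velocity.
Qed.

End Tube.

(** * Triviality of the wane groups *)

Lemma dot_gt0 {R : realType} {n} (v : 'rV[R]_n) : v != 0 -> 0 < dot v v.
Proof.
move=> v0; rewrite /dot mxE.
have -> : \sum_j v 0 j * v^T j 0 = \sum_j v 0 j ^+ 2.
  by apply: eq_bigr => j _; rewrite mxE expr2.
apply: lt_le_trans (sqr_norm_ler_sum v).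
by rewrite exprn_gt0 // normr_gt0.
Qed.

Section KaluzaKlein.
Context {R : realType} {n m : nat} {M : manifold R n} {P : manifold R (n + m)}.
Variables (pi : P -> M) (act : P -> 'rV[R]_m -> P) (gM : metric_field M)
  (omega : P -> 'rV[R]_(n + m) -> 'rV[R]_m) (gG : 'rV[R]_m -> 'rV[R]_m -> R).
Hypotheses (gM_riemannian : riemannian_metric gM)
  (P_principal : principal_torus_bundle pi act)
  (omega_conn : connection_form act omega)
  (gG_inner : inner_product gG).

Let g (eps : R) := connection_metric pi gM omega gG eps.

(** Every point of P is the center of some tube, on which there is an adapted
    frame. *)
Lemma sasaki_speed_bounded eps c w t : 0 < eps ->
  smooth_curve c -> smooth_field_along c w -> bounded_at (sasaki_speed (g eps) c w) t.
Proof.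
move=> eps0 sc sw; have [[pi_smooth _] act_free act_smooth _ loc] := P_principal.
have [U [s [oU Ux triv]]] := loc (pi (c t)).
have [r [K [lam [r0 _ F]]]] := kk_adapted_frame gM_riemannian pi_smooth act_free
  act_smooth omega_conn gG_inner oU Ux triv (ltW eps0).
apply: (speed_bounded_at (F eps eps0 (lexx _)) sc sw).
by split; [exact: chart_at_dom|rewrite /base_coord subrr normr0].
Qed.

(** The identification iota enters the separating function only through the
    norms of iota u and iota (v - u), which are those of u and v - u whatever
    eps is; hence the constants can be chosen before eps. *)
Lemma sasaki_fiber_separation (p : P) (u v : 'rV[R]_(n + m)) : u != v ->
  exists2 d : R, 0 < d & forall eps (iota : {linear 'rV[R]_(n + m) -> 'rV[R]_(n + m)}),
    0 < eps -> eps <= 1 -> linear_isometry (g eps p) iota ->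
    d <= sasaki_dist (g eps) (p, iota u) (p, iota v).
Proof.
move=> uv; have [[pi_smooth _] act_free act_smooth _ loc] := P_principal.
have [U [s [oU Ux triv]]] := loc (pi p).
have [r [K [lam [r0 hr F]]]] := kk_adapted_frame gM_riemannian pi_smooth act_free
  act_smooth omega_conn gG_inner oU Ux triv (@ler01 R).
have F1 := F 1 ltr01 (lexx _).
have K0 := frame_K F1; have lam0 := frame_lam F1.
pose xi := base_coord pi (pi p).
pose z0 := xi p.
pose NK : R := (n + m)%:R ^+ 2 * K + 1.
have NK0 : 0 < NK by rewrite ltr_wpDl // mulr_ge0 // exprn_ge0.
have duv : 0 < dot (u - v) (u - v) by rewrite dot_gt0 // subr_eq0.
(* with this b, the second quadratic term is at least 1 at iota v *)
pose b := NK / dot (u - v) (u - v).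
have b0 : 0 < b by rewrite divr_gt0.
(* the constant a of tube_exit *)
pose a := (2 / r) ^+ 2.
have a0 : 0 < a by rewrite exprn_gt0 // divr_gt0.
(* by coercivity, w0 bounds the components of iota u *)
pose w0 := Num.sqrt (dot u u / lam).
pose L := separator_lipschitz n (n + m) K lam a b w0.
have Op : tube pi (pi p) r p.
  by split; [exact: chart_at_dom|rewrite /base_coord subrr normr0].
exists L^-1.
  rewrite invr_gt0; apply: (separator_lipschitz_gt0 (W0 := 0) F1 a0 b0).
  by rewrite normr0 sqrtr_ge0.
rewrite /g => eps iota eps0 eps1 iso.
have Fe := F eps eps0 eps1.
pose th := kk_frame pi omega (pi p) eps.
pose W0 := th p (iota u).
have W0w : `|W0| <= w0.
  rewrite /w0 -[`|W0|]ger0_norm // -sqrtr_sqr ler_wsqrtr // ler_pdivlMr // mulrC.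
  apply: le_trans (frame_coercive Fe _ Op) _.
  by rewrite -(frame_metric Fe) // iso.
pose sep := @separator R n (n + m) P (tube pi (pi p) r) th xi z0 W0 a b.
have tu : sep (p, iota u) = 1.
  rewrite /sep /separator /= asboolT // /separator_arg.
  rewrite big1 ?mulr0 => [|i _]; last by rewrite subrr expr0n.
  rewrite big1 ?mulr0 => [|i _]; last by rewrite subrr expr0n.
  by rewrite !addr0 bump1.
have tv : sep (p, iota v) = 0.
  rewrite /sep /separator /= asboolT // bump_le0 // /separator_arg.
  rewrite big1 ?mulr0 => [|i _]; last by rewrite subrr expr0n.
  rewrite addr0 mulNr subr_le0.
  have linth : linear (th p) by exact: frame_linear Fe p.
  have e : th p (iota (v - u)) = th p (iota v) - W0.
    by rewrite linearB -scaleN1r [iota v + _]addrC linth scaleN1r addrC.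
  have h1 : dot (u - v) (u - v) <= NK * `|th p (iota (v - u))| ^+ 2.
    have -> : dot (u - v) (u - v) = dot (v - u) (v - u).
      by rewrite /dot -opprB linearN mulNmx mulmxN opprK.
    rewrite -iso (frame_metric Fe) //.
    apply: le_trans (ler_norm _) _.
    apply: le_trans (mform_ler _ _ (fun i j => frame_bounded Fe i j Op)) _.
    by rewrite -mulrA -expr2 ler_wpM2r ?exprn_ge0 // lerDl.
  rewrite /b mulrAC ler_pdivlMr // mul1r; apply: le_trans h1 _.
  rewrite ler_pM2l // e; apply: le_trans (sqr_norm_ler_sum _) _.
  by apply: ler_sum => j _; rewrite !mxE.
have xi_C1 c t i : smooth_curve c -> tube pi (pi p) r (c t) -> C1_at (fun s => xi (c s) 0 i) t.
  by move=> sc [dq _]; have [] := base_coord_curve pi_smooth i sc dq.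
have xi_speed c t i : smooth_curve c -> tube pi (pi p) r (c t) ->
    `|'d (fun s => xi (c s) 0 i) t (1:R)| <= `|th (c t) (velocity c t)|.
  move=> sc [dq _]; have [_ ->] := base_coord_curve pi_smooth i sc dq.
  by apply: le_trans (coord_ler _ _) _; exact: (row_mx_norm_ge _ _).1.
have speedB c w : smooth_curve c -> smooth_field_along c w ->
    forall t, bounded_at (sasaki_speed (g eps) c w) t.
  by move=> sc sw t; exact: sasaki_speed_bounded.
have exitP q : ~ tube pi (pi p) r q -> \forall q' \near q, tube pi (pi p) r q' ->
    1 <= a * \sum_i (xi q' 0 i - z0 0 i) ^+ 2.
  exact: tube_exit.
have := separator_sasaki_dist Fe xi_C1 xi_speed speedB a0 b0 W0w exitP p (iota u) (iota v).
by rewrite -/sep tu tv subr0 div1r.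
Qed.

End KaluzaKlein.

Theorem corollary3p3 (R : realType) (n m : nat)
  (M : manifold R n) (P : manifold R (n + m))
  (pi : P -> M) (act : P -> 'rV[R]_m -> P)
  (gM : metric_field M) (omega : P -> 'rV[R]_(n + m) -> 'rV[R]_m)
  (gG : 'rV[R]_m -> 'rV[R]_m -> R) (eps : nat -> R)
  (gM_riemannian : riemannian_metric gM)
  (gM_proper : proper_metric gM)
  (P_principal : principal_torus_bundle pi act)
  (omega_connection : connection_form act omega)
  (gG_inner : inner_product gG)
  (eps_gt0 : forall j, 0 < eps j)
  (eps_cvg0 : eps @ \oo --> 0) :
  forall (x : M) (p : P) (dinf : 'rV[R]_(n + m) -> 'rV[R]_(n + m) -> R),
    pi p = x ->
    sasaki_fiber_limit
      (fun j => connection_metric pi gM omega gG (eps j)) p dinf ->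
    forall G : set 'M[R]_(n + m), wane_group dinf G <-> G = [set 1%:M].
Proof.
move=> x p dinf _ [iota [sub [iso sub_incr dcvg]]] G.
have dlim u v : (fun j => sasaki_dist (connection_metric pi gM omega gG (eps (sub j)))
    (p, iota (sub j) u) (p, iota (sub j) v)) @ \oo --> dinf u v.
  have c1 : compact [set (u, v)] by exact: compact_set1.
  by move: dcvg => /fam_cvgP/(_ _ c1); rewrite uniform_set1.
(* an increasing sequence of indices tends to infinity, so eps <= 1 eventually *)
have subge j : (j <= sub j)%N.
  elim: j => // j IH; apply: leq_ltn_trans IH _; exact: sub_incr.
have eps1 : \forall j \near \oo, eps (sub j) <= 1.
  have h : \forall j \near \oo, `|0 - eps j| < 1 by exact: (cvgrPdist_lt _ _).1 eps_cvg0 1 ltr01.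
  have [N _ hN] := h.
  exists N => // j /= Nj; have := hN (sub j) (leq_trans Nj (subge j)).
  by rewrite /= sub0r normrN (ger0_norm (ltW (eps_gt0 _))); exact: ltW.
have dinf0 u v : dinf u v = 0 <-> v = u.
  split=> [d0|->]; last first.
    have := dlim u u.
    under eq_fun do rewrite sasaki_dist_refl.
    by move=> h; apply: (@cvg_unique R (@Rhausdorff R) _ _ _ _ h); exact: cvg_cst.
  apply/eqP/negPn/negP => vu; rewrite eq_sym in vu.
  have [d dpos hd] := sasaki_fiber_separation gM_riemannian P_principal omega_connection gG_inner p vu.
  have : d <= dinf u v.
    apply: (cvgr_to_ge (dlim u v)).
    by apply: filterS eps1 => j epsj; exact: hd.
  by rewrite d0 leNgt dpos.
split=> [[[orth G1 _ _ _] Gd]|->].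
  apply/seteqP; split=> [A GA|A ->] //=.
  have h (u : 'rV[R]_(n + m)) : u *m A^T = u by apply/dinf0/Gd; exists A.
  apply: trmx_inj; rewrite trmx1; apply/row_matrixP => i.
  by rewrite -[A^T]mul1mx row_mul h.
split.
  split.
  - by move=> A ->; rewrite trmx1 mulmx1.
  - by [].
  - by move=> A B -> ->; rewrite mulmx1.
  - by move=> A ->; exact: invmx1.
  - exact: compact_set1.
move=> u v; split=> [/dinf0 ->|[A [-> ->]]].
  by exists 1%:M; split=> //; rewrite trmx1 mulmx1.
by rewrite trmx1 mulmx1; apply/dinf0.
Qed.
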